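(* Let $\mathcal{J}=(a,b)$ be a finite interval, $m\geq3$, $\varepsilon_0>0$, and for each $\varepsilon\in[0,\varepsilon_0]$ let $Q_\varepsilon\in L_1(\mathcal{J};\mathbb{C})$ and $\alpha(\varepsilon),\beta(\varepsilon)\in\mathbb{C}^{m\times m}$. Let $L_\varepsilon$ be the operator in $L_2(\mathcal{J};\mathbb{C})$ given by $L_\varepsilon y=i^mD^{[m]}_\varepsilon y$ on $$\operatorname{Dom}(L_\varepsilon)=\{y\in\operatorname{Dom}(L^\varepsilon_{\max}):\ \alpha(\varepsilon)\mathcal{Y}_\varepsilon(a)+\beta(\varepsilon)\mathcal{Y}_\varepsilon(b)=0\},$$ where $\mathcal{Y}_\varepsilon(x)=(D^{[0]}_\varepsilon y(x),\dots,D^{[m-1]}_\varepsilon y(x))\in\mathbb{C}^m$. Suppose the resolvent set $\rho(L_0)$ is nonempty and, as $\varepsilon\to0+$, (1) $\|(Q_\varepsilon-Q_0)^\vee\|_C\to0$, where $c^\vee(t):=\int_a^tc(s)\,ds$ and $\|\cdot\|_C$ is the sup-norm on $[a,b]$; (2) $\alpha(\varepsilon)\to\alpha(0)$ and $\beta(\varepsilon)\to\beta(0)$. Then $L_\varepsilon$ converges to $L_0$ in the norm resolvent sense: there is $\mu\in\rho(L_0)$ with $\mu\in\rho(L_\varepsilon)$ for all sufficiently small $\varepsilon$ and $\|(L_\varepsilon-\mu)^{-1}-(L_0-\mu)^{-1}\|\to0$ as $\varepsilon\to0+$.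
   Context: Quasi-derivatives associated with $Q_\varepsilon$: $D^{[k]}_\varepsilon y=y^{(k)}$ for $k=0,\dots,m-2$; $D^{[m-1]}_\varepsilon y=y^{(m-1)}+i^{-m}Q_\varepsilon y$; $D^{[m]}_\varepsilon y=(D^{[m-1]}_\varepsilon y)'-i^{-m}Q_\varepsilon D^{[1]}_\varepsilon y$. The maximal operator $L^\varepsilon_{\max}$ acts by $y\mapsto i^mD^{[m]}_\varepsilon y$ on $\{y: D^{[k]}_\varepsilon y\in AC([a,b];\mathbb{C}),\ k=0,\dots,m-1,\ D^{[m]}_\varepsilon y\in L_2(\mathcal{J};\mathbb{C})\}$. This regularizes the formal expression $i^my^{(m)}+q_\varepsilon y$ with $q_\varepsilon=Q_\varepsilon'$. *)

(* Defs.v *)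
From HB Require Import structures.
From mathcomp Require Import all_boot all_order all_algebra.
From mathcomp Require Import all_classical all_reals all_analysis.
From mathcomp Require Import complex.
Set Implicit Arguments. Unset Strict Implicit. Unset Printing Implicit Defensive.
Import Order.TTheory GRing.Theory Num.Theory.
Local Open Scope classical_set_scope.
Local Open Scope ring_scope.
Local Open Scope complex_scope.

Section QuasiDerivativeOperators.
Variable R : realType.
Local Notation C := R[i].
Local Notation mu := (@lebesgue_measure R).

(* f : (a,b) -> C is in L_1(J;C) : real and imaginary parts Lebesgue integrable
   (the closed interval [a,b] differs from J = (a,b) by a null set). *)
Definition cL1 (a b : R) (f : R -> C) : Prop :=
  mu.-integrable `[a, b] (fun x => (complex.Re (f x))%:E) /\
  mu.-integrable `[a, b] (fun x => (complex.Im (f x))%:E).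

Definition cint (a t : R) (f : R -> C) : C :=
  (Rintegral mu `[a, t] (fun x => complex.Re (f x)))%:C
  + 'i * (Rintegral mu `[a, t] (fun x => complex.Im (f x)))%:C.

Definition csqnorm (z : C) : R := complex.Re z ^+ 2 + complex.Im z ^+ 2.

Definition cL2 (a b : R) (f : R -> C) : Prop :=
  measurable_fun `[a, b] (fun x => complex.Re (f x)) /\
  measurable_fun `[a, b] (fun x => complex.Im (f x)) /\
  mu.-integrable `[a, b] (fun x => (csqnorm (f x))%:E).

Definition cL2norm (a b : R) (f : R -> C) : R :=
  Num.sqrt (Rintegral mu `[a, b] (fun x => csqnorm (f x))).

Definition ae_eq (a b : R) (f g : R -> C) : Prop :=
  {ae mu, forall x, a <= x <= b -> f x = g x}.

(* z is absolutely continuous on [a,b] with a.e.-derivative w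
   (Lebesgue: z in AC([a,b];C) iff z(x) = z(a) + \int_a^x z' with z' in L_1). *)
Definition AC_with_deriv (a b : R) (z w : R -> C) : Prop :=
  cL1 a b w /\ forall x, a <= x <= b -> z x = z a + cint a x w.

(* z k = D^[k] y (k = 0..m-1), each absolutely continuous with a.e.-derivative w k;
   D^[k] y = y^(k) for k <= m-2, D^[m-1] y = y^(m-1) + i^-m Q y. *)
Definition quasi_derivs (m : nat) (a b : R) (Q y : R -> C)
    (z w : nat -> R -> C) : Prop :=
  (forall x, a <= x <= b -> z 0%N x = y x) /\
  (forall k, (k < m)%N -> AC_with_deriv a b (z k) (w k)) /\
  (forall k, (k.+1 <= m - 2)%N -> ae_eq a b (z k.+1) (w k)) /\
  ae_eq a b (z (m - 1)%N)
        (fun x => w (m - 2)%N x + ('i ^- m) * Q x * z 0%N x).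

(* Graph of L = L(Q, alpha, beta):  (y, f) with y in Dom(L_max), the boundary
   condition alpha Y(a) + beta Y(b) = 0, and f = i^m D^[m] y, where
   D^[m] y = (D^[m-1] y)' - i^-m Q D^[1] y. *)
Definition Lgraph (m : nat) (a b : R) (Q : R -> C) (al be : 'M[C]_m)
    (y f : R -> C) : Prop :=
  exists z w : nat -> R -> C,
    [/\ quasi_derivs m a b Q y z w,
        cL2 a b y, cL2 a b f,
        ae_eq a b f (fun x => ('i ^+ m) * (w (m - 1)%N x - ('i ^- m) * Q x * z 1%N x)) &
        al *m (\col_(k < m) z (k : nat) a) + be *m (\col_(k < m) z (k : nat) b) = 0].

Definition is_resolvent (m : nat) (a b : R) (Q : R -> C) (al be : 'M[C]_m)
    (lam : C) (Rs : (R -> C) -> (R -> C)) : Prop :=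
  [/\ (forall g, cL2 a b g -> Lgraph a b Q al be (Rs g) (fun x => g x + lam * Rs g x)),
      (forall y f, Lgraph a b Q al be y f -> ae_eq a b f (fun x => lam * y x) ->
                   ae_eq a b y (fun=> 0)) &
      exists M : R, forall g, cL2 a b g -> cL2norm a b (Rs g) <= M * cL2norm a b g].

Definition in_resolvent_set (m : nat) (a b : R) (Q : R -> C) (al be : 'M[C]_m)
    (lam : C) : Prop :=
  exists Rs, is_resolvent a b Q al be lam Rs.

End QuasiDerivativeOperators.

(* Main.v *)
Require Import Defs.
From HB Require Import structures.
From mathcomp Require Import all_boot all_order all_algebra.
From mathcomp Require Import all_classical all_reals all_analysis.
From mathcomp Require Import complex.
From mathcomp Require Import measurable_realfun ring lra.
Import Order.TTheory GRing.Theory Num.Theory.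
Import numFieldNormedType.Exports.
Local Open Scope classical_set_scope.
Local Open Scope ring_scope.
Local Open Scope complex_scope.

(* With P' = i^-m (Q_eps - Q_0), P is uniformly small although P' need not be
   small in L_1, nor Q_eps bounded there.  Writing the equation as a first-order
   system for the quasi-derivatives, Q enters only in the combinations Q z_0 and
   Q z_1, and z_0, z_1 are absolutely continuous; integration by parts therefore
   turns the integrals of (Q_eps - Q_0) z_j into expressions controlled by sup |P|
   and sup |z|.  Gronwall's inequality for the system with the fixed potential Q_0
   then bounds the difference of the solutions with equal initial data.  A number
   lam in rho(L_0) makes the characteristic matrix alpha + beta Phi(b) of the
   unperturbed boundary problem invertible, which yields an a priori bound; the
   comparison carries that bound over to small eps, with constants uniform in eps,
   so that lam is in rho(L_eps) and the resolvents converge. *)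

(** * Indefinite Lebesgue integrals on [a, b] *)

(** Condition (1) allows the L_1 norm of [Q_eps] to blow up, so no constant meant to be uniform in
    eps may be computed from [Q_eps]. Hence a difference of solutions is treated as a solution of
    the [Q_0] system forced by [(Q_eps - Q_0) z_j]. Integrating this forcing by parts brings in sup
    |z| of the perturbed solution itself, which makes each a priori bound circular; it closes
    because the factor in front of sup |z| can be kept below 1/2 ([absorb]). Estimates go from the
    L_1 norm of the right-hand side to the sup norm of the quasi-derivatives. The L_2 operator norm
    follows at the end from the two inclusions, L_2 in L_1 and bounded functions in L_2, on a finite
    interval. Absolute continuity is an integral formula here, so calculus rests on one principle: a
    function whose increments over short intervals are at most e times those of a fixed [K], for
    every e > 0, is constant. It gives the product rule; its one-sided form gives the weight behind
    Gronwall's inequality and the Picard iteration. *)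

Section RealIntegral.
Variables (R : realType) (a b : R).
Local Notation mu := (@lebesgue_measure R).
Implicit Types (f g h F K : R -> R) (s t x : R).

Definition rL1 f := mu.-integrable `[a, b] (fun x => (f x)%:E).

Definition rint t f : R := Rintegral mu `[a, t] f.

(** These functions multiply L_1 into itself, and their finite bound starts every halving iteration
    below. *)
Definition rbmeas f := measurable_fun `[a, b] f /\
  exists B : R, forall x, a <= x <= b -> `|f x| <= B.

Lemma mem_itv_set x t : `[a, t]%classic x = (a <= x <= t).
Proof. by rewrite /= in_itv. Qed.

Lemma rL1_eq {f} g : (forall x, a <= x <= b -> f x = g x) -> rL1 f -> rL1 g.
Proof.
move=> fg; apply: eq_integrable => // x; rewrite inE mem_itv_set => xab.
by rewrite fg.
Qed.

Lemma rL1D f g : rL1 f -> rL1 g -> rL1 (fun x => f x + g x).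
Proof. by move=> fi gi; exact: (integrableD _ fi gi). Qed.

Lemma rL1Z c f : rL1 f -> rL1 (fun x => c * f x).
Proof. by move=> fi; exact: (integrableZl _ c fi). Qed.

Lemma rL1N f : rL1 f -> rL1 (fun x => - f x).
Proof. by move=> /(rL1Z (-1)); apply: rL1_eq => x _; rewrite mulN1r. Qed.

Lemma rL1B f g : rL1 f -> rL1 g -> rL1 (fun x => f x - g x).
Proof. by move=> fi /rL1N; exact: rL1D. Qed.

Lemma rL1_norm f : rL1 f -> rL1 (fun x => `|f x|).
Proof. exact: integrable_norm. Qed.

Lemma rL1M f g : rL1 f -> rbmeas g -> rL1 (fun x => f x * g x).
Proof.
move=> fi [mg [B gB]]; apply: (@integrableMl _ _ _ _ _ _ _ _ fi mg) => //.
exists B; split; first exact: num_real.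
by move=> M BM x /=; rewrite in_itv/= => /gB/le_trans; apply; exact: ltW.
Qed.

Lemma rbmeas_L1 f : rbmeas f -> rL1 f.
Proof.
move=> [mf [B fB]]; apply: measurable_bounded_integrable => //.
  by rewrite /= lebesgue_measure_itv/=; case: ifP => // _; rewrite -EFinB ltry.
exists B; split; first exact: num_real.
by move=> M BM x /=; rewrite in_itv/= => /fB/le_trans; apply; exact: ltW.
Qed.

Lemma rbmeas_cst c : rbmeas (fun=> c).
Proof. by split; [exact: measurable_cst | exists `|c|]. Qed.

Lemma rbmeasD f g : rbmeas f -> rbmeas g -> rbmeas (fun x => f x + g x).
Proof.
move=> [mf [B fB]] [mg [D gD]]; split; first exact: measurable_funD.
by exists (B + D) => x xab; rewrite (le_trans (ler_normD _ _))// lerD ?fB ?gD.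
Qed.

Lemma rbmeasM f g : rbmeas f -> rbmeas g -> rbmeas (fun x => f x * g x).
Proof.
move=> [mf [B fB]] [mg [D gD]]; split; first exact: measurable_funM.
by exists (B * D) => x xab; rewrite normrM ler_pM ?fB ?gD.
Qed.

Lemma rbmeasN f : rbmeas f -> rbmeas (fun x => - f x).
Proof.
move=> /(rbmeasM _ _ (rbmeas_cst (-1))).
by congr rbmeas; apply/funext => x; rewrite mulN1r.
Qed.

Lemma rbmeas_norm f : rbmeas f -> rbmeas (fun x => `|f x|).
Proof.
move=> [mf [B fB]]; split; first exact: measurableT_comp.
by exists B => x xab; rewrite normr_id fB.
Qed.

Lemma rL1_sub t f : t <= b -> rL1 f -> mu.-integrable `[a, t] (EFin \o f).
Proof.
move=> tb; apply: integrableS => // x; rewrite !mem_itv_set => /andP[-> /=].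
by move=> /le_trans; exact.
Qed.

Lemma rint_eq t f g : (forall x, a <= x <= t -> f x = g x) ->
  rint t f = rint t g.
Proof.
by move=> fg; apply: eq_Rintegral => x; rewrite inE mem_itv_set => /fg.
Qed.

Lemma rintD t f g : t <= b -> rL1 f -> rL1 g ->
  rint t (fun x => f x + g x) = rint t f + rint t g.
Proof. by move=> tb fi gi; apply: RintegralD => //; exact: rL1_sub. Qed.

Lemma rintZ t c f : t <= b -> rL1 f ->
  rint t (fun x => c * f x) = c * rint t f.
Proof. by move=> tb fi; apply: RintegralZl => //; exact: rL1_sub. Qed.

Lemma rintN t f : t <= b -> rL1 f -> rint t (fun x => - f x) = - rint t f.
Proof.
move=> tb fi; rewrite -mulN1r -rintZ//; apply: rint_eq => x _.
by rewrite mulN1r.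
Qed.

Lemma rintB t f g : t <= b -> rL1 f -> rL1 g ->
  rint t (fun x => f x - g x) = rint t f - rint t g.
Proof. by move=> tb fi gi; rewrite rintD ?rintN//; exact: rL1N. Qed.

Lemma rint_start f : rint a f = 0.
Proof. by rewrite /rint set_itv1 Rintegral_set1. Qed.

Lemma rint_cst t c : a <= t -> rint t (fun=> c) = c * (t - a).
Proof.
rewrite /rint Rintegral_cst//= lebesgue_measure_itv/= lte_fin le_eqVlt.
by case/predU1P => [->|->//]; rewrite ltxx subrr.
Qed.

Lemma rint_sub s t f : a <= s -> s <= t -> t <= b -> rL1 f ->
  rint t f - rint s f = Rintegral mu `]s, t] f.
Proof.
move=> as_ st tb fi.
by rewrite /rint Rintegral_itvB// ?bnd_simp//; exact: rL1_sub.
Qed.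

Lemma rL1_subo s t f : a <= s -> t <= b -> rL1 f ->
  mu.-integrable `]s, t] (EFin \o f).
Proof.
move=> as_ tb; apply: integrableS => //= x /=; rewrite !in_itv/= => /andP[sx xt].
by rewrite (le_trans as_ (ltW sx)) (le_trans xt tb).
Qed.

Lemma rint_incr_le s t f g : a <= s -> s <= t -> t <= b -> rL1 f -> rL1 g ->
  (forall x, s <= x <= t -> f x <= g x) ->
  rint t f - rint s f <= rint t g - rint s g.
Proof.
move=> as_ st tb fi gi fg; rewrite !rint_sub//.
apply: le_Rintegral => //; [exact: rL1_subo|exact: rL1_subo|].
by move=> x /=; rewrite in_itv/= => /andP[/ltW sx xt]; rewrite fg// sx.
Qed.

Lemma rint_le t f g : a <= t -> t <= b -> rL1 f -> rL1 g ->
  (forall x, a <= x <= t -> f x <= g x) -> rint t f <= rint t g.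
Proof.
move=> at_ tb fi gi fg; have := rint_incr_le _ _ _ _ (lexx a) at_ tb fi gi fg.
by rewrite !rint_start !subr0.
Qed.

Lemma rint_norm t f : a <= t -> t <= b -> rL1 f ->
  `|rint t f| <= rint t (fun x => `|f x|).
Proof. by move=> at_ tb fi; apply: le_normr_Rintegral => //; exact: rL1_sub. Qed.

Lemma rint_mono s t f : a <= s -> s <= t -> t <= b -> rL1 f ->
  (forall x, a <= x <= b -> 0 <= f x) -> rint s f <= rint t f.
Proof.
move=> as_ st tb fi f0; rewrite -subr_ge0 rint_sub//; apply: Rintegral_ge0 => x.
rewrite /= in_itv/= => /andP[sx xt]; apply: f0.
by rewrite (le_trans as_ (ltW sx)) (le_trans xt tb).
Qed.

Lemma rint_ge0 t f : a <= t -> t <= b -> rL1 f ->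
  (forall x, a <= x <= b -> 0 <= f x) -> 0 <= rint t f.
Proof. by move=> at_ tb fi f0; rewrite -(rint_start f) rint_mono. Qed.

(** Absolute continuity of the Lebesgue integral, applied to [f] extended by zero to the whole
    line. *)
Lemma rint_unif f : rL1 f -> forall e : R, 0 < e -> exists2 d : R, 0 < d &
  forall s t, a <= s -> s <= t -> t <= b -> t - s < d ->
    rint t (fun x => `|f x|) - rint s (fun x => `|f x|) < e.
Proof.
move=> fi e e0.
have fT : mu.-integrable setT (EFin \o (f \_ `[a, b])).
  rewrite -restrict_EFin.
  have [H _] := @integrable_mkcond _ _ _ mu `[a, b] (EFin \o f) (measurable_itv _).
  exact: H.
have [d [d0 H]] := integral_normr_continuous fT e0.
exists d => // s t as_ st tb tsd.
rewrite rint_sub//; last exact: rL1_norm.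
have -> : Rintegral mu `]s, t] (fun x => `|f x|)
        = Rintegral mu `]s, t] (fun x => `|(f \_ `[a, b]) x|).
  apply: eq_Rintegral => x; rewrite inE/= in_itv/= => /andP[sx xt].
  rewrite patchE mem_set// mem_itv_set.
  by rewrite (le_trans as_ (ltW sx)) (le_trans xt tb).
apply: H => //; rewrite /= lebesgue_measure_itv/= lte_fin.
by case: ifP => _ //; rewrite -EFinB lte_fin.
Qed.

(* Telescope the increments over a uniform partition. *)
Lemma le_of_small_increments F K :
  (forall e : R, 0 < e -> exists2 d : R, 0 < d &
     forall s t, a <= s -> s <= t -> t <= b -> t - s < d ->
       - (e * (K t - K s)) <= F t - F s) ->
  forall x, a <= x <= b -> F a <= F x.
Proof.
move=> HF x /andP[ax xb].
have step e : 0 < e -> - (e * (K x - K a)) <= F x - F a.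
  move=> /HF[d d0 Hd].
  have [n ltn] : exists n : nat, (x - a) / d < n.+1%:R.
    exists (Num.truncn ((x - a) / d)); rewrite truncnS_gt//.
  have n0 : 0 < n.+1%:R :> R by rewrite ltr0n.
  pose p (i : nat) := a + (x - a) * (i%:R / n.+1%:R).
  have px : p n.+1 = x by rewrite /p divff ?gt_eqF// mulr1 addrC subrK.
  have p0 : p 0%N = a by rewrite /p mul0r mulr0 addr0.
  have pmono i j : (i <= j)%N -> p i <= p j.
    move=> ij; rewrite /p lerD2l ler_wpM2l ?subr_ge0//.
    by rewrite ler_wpM2r ?invr_ge0 ?ler_nat// ltW.
  have key i : (i <= n.+1)%N -> - (e * (K (p i) - K a)) <= F (p i) - F a.
    elim: i => [_|i IH lein]; first by rewrite p0 !subrr mulr0 oppr0.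
    have {}IH := IH (ltnW lein).
    have h1 : - (e * (K (p i.+1) - K (p i))) <= F (p i.+1) - F (p i).
      apply: Hd.
      - by rewrite -p0 pmono.
      - exact: pmono.
      - by rewrite (le_trans _ xb)// -px pmono.
      - rewrite /p opprD addrACA subrr add0r -mulrBr -mulrBl -natrB// subSnn.
        by rewrite mul1r ltr_pdivrMr// mulrC -ltr_pdivrMr.
    lra.
  by have := key n.+1 (leqnn _); rewrite px.
rewrite leNgt; apply/negP => lt.
have D0 : 0 < F a - F x by rewrite subr_gt0.
(* The contradiction comes from [e = (F a - F x) / (|K x - K a| + 1)]; the 1 keeps the denominator
   positive. *)
have A0 : 0 < `|K x - K a| + 1 by rewrite ltr_wpDl.
have := step _ (divr_gt0 D0 A0); apply/negP; rewrite -ltNge.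
rewrite -[ltLHS]opprB ltrN2 mulrAC ltr_pdivrMr// ltr_pM2l//.
by rewrite (le_lt_trans (ler_norm _))// ltrDl.
Qed.

(** Plays the role of [zero derivative implies constant], with [K] an indefinite integral instead of
    the identity, so that L_1 densities are covered. *)
Lemma eq_of_small_increments F K :
  (forall e : R, 0 < e -> exists2 d : R, 0 < d &
     forall s t, a <= s -> s <= t -> t <= b -> t - s < d ->
       `|F t - F s| <= e * (K t - K s)) ->
  forall x, a <= x <= b -> F x = F a.
Proof.
move=> HF x xab; apply/eqP; rewrite eq_le; apply/andP; split; last first.
  apply: (le_of_small_increments F K) => // e /HF[d d0 Hd]; exists d => // s t h1 h2 h3 h4.
  by have := Hd s t h1 h2 h3 h4; rewrite ler_norml => /andP[].
rewrite -lerN2; apply: (le_of_small_increments (fun x => - F x) K) => //.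
move=> e /HF[d d0 Hd]; exists d => // s t h1 h2 h3 h4.
have := Hd s t h1 h2 h3 h4; rewrite ler_norml => /andP[_]; lra.
Qed.

Definition rAC F f := rL1 f /\ forall x, a <= x <= b -> F x = F a + rint x f.

Lemma rAC_incr F f s t : rAC F f -> a <= s -> s <= t -> t <= b ->
  `|F t - F s| <= rint t (fun x => `|f x|) - rint s (fun x => `|f x|).
Proof.
move=> [fi Fe] as_ st tb.
rewrite Fe ?(le_trans as_ st)// (Fe s) ?as_ ?(le_trans st)//.
rewrite opprD addrACA subrr add0r ler_norml; apply/andP; split.
  have : rint t (fun x => - f x) - rint s (fun x => - f x)
      <= rint t (fun x => `|f x|) - rint s (fun x => `|f x|).
    apply: rint_incr_le => //; [exact: rL1N|exact: rL1_norm|].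
    by move=> x _; rewrite -normrN ler_norm.
  by rewrite !rintN ?(le_trans st)//; lra.
by apply: rint_incr_le => //; [exact: rL1_norm|move=> x _; exact: ler_norm].
Qed.

Lemma rAC_unif F f : rAC F f -> forall e : R, 0 < e -> exists2 d : R, 0 < d &
  forall s t, a <= s -> s <= t -> t <= b -> t - s < d -> `|F t - F s| < e.
Proof.
move=> FAC e e0; have [d d0 Hd] := rint_unif f FAC.1 _ e0.
exists d => // s t h1 h2 h3 h4; apply: le_lt_trans (Hd _ _ h1 h2 h3 h4).
exact: rAC_incr.
Qed.

End RealIntegral.

(** * Absolutely continuous functions and Volterra inequalities *)

Section RealAC.
Variables (R : realType) (a b : R).
Hypothesis leab : a <= b.
Local Notation rL1 := (rL1 R a b).
Local Notation rbmeas := (rbmeas R a b).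
Local Notation rAC := (rAC R a b).
Local Notation rint := (rint R a).
Implicit Types (f g h F G K : R -> R) (s t x : R).

Lemma rint_incr_norm s t f g : a <= s -> s <= t -> t <= b -> rL1 f -> rL1 g ->
  (forall x, s <= x <= t -> `|f x| <= g x) ->
  `|rint t f - rint s f| <= rint t g - rint s g.
Proof.
move=> as_ st tb fi gi fg; rewrite ler_norml; apply/andP; split.
  have : rint t (fun x => - f x) - rint s (fun x => - f x)
      <= rint t g - rint s g.
    apply: (rint_incr_le _ _ b) => //; first exact: rL1N.
    by move=> x /fg; apply: le_trans; rewrite -normrN ler_norm.
  by rewrite !(rintN _ _ b) ?(le_trans st)//; lra.
apply: (rint_incr_le _ _ b) => // x /fg; apply: le_trans; exact: ler_norm.
Qed.

Lemma rint_bmeas f : rL1 f -> rbmeas (fun x => rint x f).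
Proof.
move=> fi; split.
  apply: subspace_continuous_measurable_fun => //.
  exact: parameterized_integral_continuous.
exists (rint b (fun x => `|f x|)) => x /andP[ax xb].
rewrite (le_trans (rint_norm _ _ b _ _ ax xb fi))//.
by apply: (rint_mono _ _ b) => //; exact: rL1_norm.
Qed.

Lemma rAC_bmeas F f : rAC F f -> rbmeas F.
Proof.
move=> [fi Fe]; have [m [B HB]] := rbmeasD _ _ _ _ _ (rbmeas_cst _ _ _ (F a)) (rint_bmeas f fi).
split; last by exists B => x xab; rewrite Fe// HB.
apply: eq_measurable_fun m => x; rewrite inE mem_itv_set => xab.
by rewrite -Fe.
Qed.

(** The discrete product rule [G s * (F t - F s) + F t * (G t - G s)] freezes one factor at each
    endpoint. Replacing frozen factors by running ones costs, by uniform continuity, at most e times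
    the increment of the integral of [|f| + |g|]. *)
Lemma rAC_mul F f G g : rAC F f -> rAC G g ->
  rAC (fun x => F x * G x) (fun x => f x * G x + F x * g x).
Proof.
move=> Ff Gg; have [fi Fe] := Ff; have [gi Ge] := Gg.
have FB := rAC_bmeas _ _ Ff; have GB := rAC_bmeas _ _ Gg.
have fGi : rL1 (fun x => f x * G x) by exact: rL1M.
have Fgi : rL1 (fun x => F x * g x).
  by apply: rL1_eq (rL1M _ _ _ _ _ gi FB) => x _; rewrite mulrC.
have pi_ := rL1D _ _ _ _ _ fGi Fgi.
split => //.
pose N x := F x * G x - rint x (fun x => f x * G x + F x * g x).
suff NE x : a <= x <= b -> N x = N a.
  by move=> x /NE; rewrite /N rint_start subr0 => <-; rewrite subrK.
move: x; apply: (eq_of_small_increments _ a b N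
  (fun x => rint x (fun x => `|f x| + `|g x|))) => e e0.
have [d1 d10 Hd1] := rAC_unif _ _ _ _ _ Ff e e0.
have [d2 d20 Hd2] := rAC_unif _ _ _ _ _ Gg e e0.
exists (Num.min d1 d2); first by rewrite lt_min d10.
move=> s t as_ st tb; rewrite lt_min => /andP[ts1 ts2].
have sb := le_trans st tb; have at_ := le_trans as_ st.
have i1 : rL1 (fun x => G s * f x) by exact: rL1Z.
have i2 : rL1 (fun x => F t * g x) by exact: rL1Z.
have i3 := rL1D _ _ _ _ _ i1 i2.
have -> : N t - N s = rint t (fun x => (G s * f x + F t * g x) -
                                       (f x * G x + F x * g x))
                    - rint s (fun x => (G s * f x + F t * g x) -
                                       (f x * G x + F x * g x)).
  rewrite !(rintB _ _ b _ (fun x => G s * f x + F t * g x))//.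
  rewrite !(rintD _ _ b _ (fun x => G s * f x))//.
  rewrite !(rintZ _ _ b)//.
  rewrite /N (Fe t) ?at_// (Fe s) ?as_// (Ge t) ?at_// (Ge s) ?as_//.
  ring.
have i4 : rL1 (fun x => `|f x| + `|g x|).
  by apply: rL1D; exact: rL1_norm.
rewrite mulrBr -!(rintZ _ _ b)//.
apply: rint_incr_norm => //; [exact: rL1B|exact: rL1Z|].
move=> x /andP[sx xt].
have -> : G s * f x + F t * g x - (f x * G x + F x * g x)
        = (G s - G x) * f x + (F t - F x) * g x by ring.
rewrite (le_trans (ler_normD _ _))// !normrM mulrDr lerD// ler_wpM2r//.
  rewrite distrC; apply: ltW; apply: Hd2 => //; first exact: le_trans xt tb.
  by apply: le_lt_trans ts2; rewrite lerD2r.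
apply: ltW; apply: Hd1 => //; first exact: le_trans sx.
by apply: le_lt_trans ts1; rewrite lerD2l lerN2.
Qed.

(* [w] plays the role of the weight in Bielecki's norm [sup |y| / w], in which
   Volterra operators with kernel [h] contract by a factor 2. *)
Lemma volterra_weight h : rL1 h -> (forall x, a <= x <= b -> 0 <= h x) ->
  exists w : R -> R, exists K : R, [/\ rbmeas w,
    forall x, a <= x <= b -> 1 <= w x <= K &
    forall x, a <= x <= b -> rint x (fun x => h x * w x) <= w x / 2].
Proof.
(* The exponent 2 is what produces the contraction factor 1/2, since formally [w' = 2 h w]. *)
move=> hi h0; pose w x := expR (2 * rint x h).
have mono s t : a <= s -> s <= t -> t <= b -> rint s h <= rint t h.
  by move=> *; apply: (rint_mono _ _ b).
have wmono s t : a <= s -> s <= t -> t <= b -> w s <= w t.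
  by move=> *; rewrite ler_expR ler_pM2l// mono.
have w1 x : a <= x <= b -> 1 <= w x <= w b.
  move=> /andP[ax xb]; rewrite wmono// andbT -expR0 ler_expR.
  by rewrite mulr_ge0// (rint_ge0 _ _ b).
have wB : rbmeas w.
  split; last first.
    by exists (w b) => x /w1 /andP[_]; rewrite ger0_norm// expR_ge0.
  apply: measurableT_comp; first exact: measurable_expR.
  by have [] := rbmeasM _ _ _ _ _ (rbmeas_cst _ _ _ 2) (rint_bmeas _ hi).
exists w, (w b); split => //.
have hwi : rL1 (fun x => h x * w x) by exact: rL1M.
(* Formally [F] is constant, equal to 1/2; the increment criterion gives [F a <= F x]. *)
move=> x xab; pose F x := w x / 2 - rint x (fun x => h x * w x).
suff : F a <= F x.
  by rewrite /F !rint_start /w rint_start mulr0 expR0 subr0; lra.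
move: x xab; apply: (le_of_small_increments _ a b F (fun x => rint x h)) => e e0.
have wb0 : 0 < w b by exact: expR_gt0.
(* This [d] forces [D < e / (2 * w b)], hence [w t - w s <= e]. *)
have [d d0 Hd] := rint_unif _ _ _ _ hi _ (divr_gt0 e0 (mulr_gt0 (ltr0Sn R 1) wb0)).
exists d => // s t as_ st tb tsd.
have sb := le_trans st tb; have at_ := le_trans as_ st.
have := Hd _ _ as_ st tb tsd.
have nE y : a <= y -> y <= b -> rint y (fun x => `|h x|) = rint y h.
  move=> ay yb; apply: rint_eq => x /andP[ax xy]; rewrite ger0_norm ?h0// ax.
  exact: le_trans yb.
rewrite !nE//; set D := rint t h - rint s h => HD.
have D0 : 0 <= D by rewrite subr_ge0 mono.
have e1 : rint t (fun x => h x * w x) - rint s (fun x => h x * w x) <= w t * D.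
  rewrite /D mulrBr -!(rintZ _ _ b)//; apply: (rint_incr_le _ _ b) => //.
    exact: rL1Z.
  move=> x /andP[sx xt]; have ax := le_trans as_ sx; have xb := le_trans xt tb.
  rewrite mulrC; apply: ler_wpM2r; first by apply: h0; rewrite ax xb.
  exact: wmono.
have wE : w t = w s * expR (2 * D).
  by rewrite /w -expRD; congr expR; rewrite -mulrDr addrC subrK.
have wE' : w s = w t * expR (- (2 * D)) by rewrite wE -mulrA -expRD subrr expR0 mulr1.
have ws0 : 0 <= w s by exact: expR_ge0.
have wt0 : 0 <= w t by exact: expR_ge0.
have wtb : w t <= w b by exact: wmono.
rewrite /F; move: e1; set I := rint t _; set J := rint s _ => e1.
clearbody D I J.
move: (w s) (w t) (w b) wb0 wE wE' ws0 wt0 wtb e1 HD => ws wt wb wb0 wE wE' ws0 wt0 wtb e1 HD.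
(* The inequality [1 + u <= exp u] is used twice: at [u = 2 D] for this lower bound, at [u = - 2 D]
   for the upper bound [e3]. *)
have e2 : ws * (2 * D) <= wt - ws.
  rewrite wE -[X in _ - X]mulr1 -mulrBr; apply: ler_wpM2l => //.
  by rewrite lerBrDl expR_ge1Dx.
have e3 : wt - ws <= wb * (2 * D).
  apply: (@le_trans _ _ (wt * (2 * D))); last by apply: ler_wpM2r => //; lra.
  rewrite wE' -[X in X - _]mulr1 -mulrBr; apply: ler_wpM2l => //.
  by rewrite lerBlDr -lerBlDl expR_ge1Dx.
have e4 : wt - ws <= e.
  by apply: (le_trans e3); move: HD; rewrite ltr_pdivlMr ?mulr_gt0//; lra.
have e5 : (wt - ws) * D <= e * D by apply: ler_wpM2r.
lra.
Qed.

(** The common exit of the halving arguments: the remainder [c / 2 ^+ n] is driven to 0 by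
    [n < 2 ^ n]. *)
Lemma le_geometric (u v c : R) : (forall n, u <= v + c / 2 ^+ n) -> u <= v.
Proof.
move=> H; rewrite leNgt; apply/negP => vu.
have D0 : 0 < u - v by rewrite subr_gt0.
have [n ltn] : exists n : nat, c / (u - v) < n.+1%:R.
  by exists (Num.truncn (c / (u - v))); rewrite truncnS_gt.
have := H n.+1; apply/negP; rewrite -ltNge -ltrBrDl.
rewrite ltr_pdivrMr ?exprn_gt0// -ltr_pdivrMl// mulrC.
by rewrite (lt_le_trans ltn)// -natrX ler_nat ltnW// ltn_expl.
Qed.

(** [K] is fixed before [F] and [E], so it depends on the kernel alone; this is the source of all
    uniformity in eps. *)
Lemma gronwall h : rL1 h -> (forall x, a <= x <= b -> 0 <= h x) ->
  exists2 K : R, 0 <= K & forall F E, rbmeas F -> 0 <= E ->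
    (forall x, a <= x <= b -> F x <= E + rint x (fun x => h x * F x)) ->
    forall x, a <= x <= b -> F x <= K * E.
Proof.
move=> hi h0; have [w [K [wB w1 wh]]] := volterra_weight h hi h0.
have K1 : 1 <= K by have := w1 a; rewrite lexx leab => /(_ isT)/andP[/le_trans]; exact.
exists (2 * K); first by lra.
move=> F E FB E0 FE x xab.
have [B HB] := FB.2.
have B0 : 0 <= B by rewrite (le_trans _ (HB a _))// lexx.
have wi : rL1 (fun x => h x * w x) by exact: rL1M.
(* If [F <= C w], the weight gives [F <= (E + C / 2) w]; the map [C -> E + C / 2] has fixed point
   [2 E], approached at rate 1/2. *)
have step n y : a <= y <= b -> F y <= (2 * E + B / 2 ^+ n) * w y.
  elim: n y => [|n IH] y yab.
    rewrite expr0 divr1 (le_trans (ler_norm _))// (le_trans (HB _ yab))//.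
    have /andP[wy _] := w1 _ yab.
    by rewrite (@le_trans _ _ (B * w y)) ?ler_peMr// ler_wpM2r//; lra.
  have /andP[ay yb] := yab; have /andP[wy _] := w1 _ yab.
  have C0 : 0 <= 2 * E + B / 2 ^+ n by rewrite addr_ge0 ?mulr_ge0 ?divr_ge0 ?exprn_ge0.
  have : rint y (fun x => h x * F x) <=
         rint y (fun x => (2 * E + B / 2 ^+ n) * (h x * w x)).
    apply: (rint_le _ _ b) => //; [exact: rL1M|exact: rL1Z|].
    move=> x' /andP[ax' xy']; have x'ab : a <= x' <= b by rewrite ax' (le_trans xy').
    by rewrite mulrCA ler_wpM2l ?h0// IH.
  rewrite (rintZ _ _ b)// => H.
  have H2 := ler_wpM2l C0 (wh _ yab).
  have H3 : E <= E * w y by rewrite ler_peMr.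
  have -> : B / 2 ^+ n.+1 = B / 2 ^+ n / 2.
    by rewrite exprS invfM; ring.
  have := FE _ yab; nra.
have /andP[wx wK] := w1 _ xab.
have w0 : 0 <= w x by lra.
apply: (@le_trans _ _ (2 * E * w x)); last first.
  by have := ler_wpM2l E0 wK; lra.
apply: (le_geometric _ _ (B * w x)) => n.
by rewrite [B * w x / _]mulrAC -mulrDl; exact: step.
Qed.

(** Meant for successive Picard differences: each step gains 1/2 in the weighted norm, and [K] pays
    for removing the weight. *)
Lemma volterra_decay h : rL1 h -> (forall x, a <= x <= b -> 0 <= h x) ->
  exists2 K : R, 0 <= K & forall (F : nat -> R -> R) B, (forall n, rbmeas (F n)) ->
    0 <= B -> (forall x, a <= x <= b -> F 0%N x <= B) ->
    (forall n x, a <= x <= b -> F n.+1 x <= rint x (fun x => h x * F n x)) ->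
    forall n x, a <= x <= b -> F n x <= K * B / 2 ^+ n.
Proof.
move=> hi h0; have [w [K [wB w1 wh]]] := volterra_weight h hi h0.
have K1 : 1 <= K by have := w1 a; rewrite lexx leab => /(_ isT)/andP[/le_trans]; exact.
exists K; first by lra.
move=> F B FB B0 F0 FS n x xab.
have wi : rL1 (fun x => h x * w x) by exact: rL1M.
have /andP[wx wK] := w1 _ xab.
apply: (@le_trans _ _ (B / 2 ^+ n * w x)); last first.
  rewrite -[K * B / _]mulrA [K * _]mulrC; apply: ler_wpM2l => //.
  by rewrite divr_ge0// exprn_ge0.
elim: n x xab {wx wK} => [|n IH] y yab.
  rewrite expr0 divr1 (le_trans (F0 _ yab))// ler_peMr//.
  by have /andP[] := w1 _ yab.
have /andP[ay yb] := yab.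
have C0 : 0 <= B / 2 ^+ n by rewrite divr_ge0 ?exprn_ge0.
apply: (le_trans (FS _ _ yab)).
apply: (@le_trans _ _ (rint y (fun x => (B / 2 ^+ n) * (h x * w x)))).
  apply: (rint_le _ _ b) => //; [exact: rL1M|exact: rL1Z|].
  move=> x' /andP[ax' xy']; have x'ab : a <= x' <= b by rewrite ax' (le_trans xy').
  by rewrite mulrCA ler_wpM2l ?h0// IH.
rewrite (rintZ _ _ b)// exprS invfM.
by have := ler_wpM2l C0 (wh _ yab); lra.
Qed.

(* Any two terms are within [2 C / 2 ^ n] of each other, so [u n - 2 C / 2 ^ n]
   is bounded by every [u p + 2 C / 2 ^ p]; the limit is its supremum. *)
Lemma geometric_limit (u : nat -> R) (C : R) :
  (forall n, `|u n.+1 - u n| <= C / 2 ^+ n) ->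
  exists l : R, forall n, `|l - u n| <= 2 * C / 2 ^+ n.
Proof.
move=> H; pose lo n := u n - 2 * C / 2 ^+ n; pose hi n := u n + 2 * C / 2 ^+ n.
have half n : C / 2 ^+ n.+1 = C / 2 ^+ n / 2 by rewrite exprS invfM; ring.
have loS n : lo n <= lo n.+1.
  have := H n; rewrite ler_norml /lo -!mulrA half mulrA => /andP[]; lra.
have hiS n : hi n.+1 <= hi n.
  have := H n; rewrite ler_norml /hi -!mulrA half mulrA => /andP[]; lra.
have C0 n : 0 <= C / 2 ^+ n by rewrite (le_trans _ (H n)).
have lo_mono n p : lo n <= lo (n + p)%N.
  by elim: p => [|p IH]; rewrite ?addn0// addnS (le_trans IH).
have hi_mono n p : hi (n + p)%N <= hi n.
  by elim: p => [|p IH]; rewrite ?addn0// addnS (le_trans _ IH).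
have lohi n p : lo n <= hi p.
  rewrite (le_trans (lo_mono n p))// (le_trans _ (hi_mono p n))// addnC /lo /hi.
  by have := C0 (p + n)%N; rewrite -!mulrA; lra.
have ub p : ubound (range lo) (hi p) by move=> _ [n _ <-].
exists (sup (range lo)) => n; rewrite ler_norml; apply/andP; split.
  have : lo n <= sup (range lo).
    by apply: ub_le_sup; [exists (hi 0%N)|exists n].
  rewrite /lo; lra.
have : sup (range lo) <= hi n by apply: ge_sup => //; exists (lo 0%N), 0%N.
rewrite /hi; lra.
Qed.

End RealAC.

(** * Complex-valued functions *)

Section ComplexCalculus.
Variables (R : realType) (a b : R).
Hypothesis leab : a <= b.
Local Notation C := R[i].
Local Notation mu := (@lebesgue_measure R).
Local Notation rL1 := (rL1 R a b).
Local Notation rbmeas := (rbmeas R a b).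
Local Notation rAC := (rAC R a b).
Local Notation rint := (rint R a).
Local Notation Re := (@complex.Re R).
Local Notation Im := (@complex.Im R).
Local Notation cL1 := (cL1 a b).
Local Notation cint := (cint a).
Local Notation ae_eq := (@Defs.ae_eq R).
Implicit Types (f g w z : R -> C) (u v c : C) (s t x : R).

(* The l^1 modulus is within a factor 2 of the usual one, and it makes the
   triangle inequality for integrals a statement about real and imaginary
   parts. *)
Definition norm1 u : R := locked (`|Re u| + `|Im u|).

Lemma norm1E u : norm1 u = `|Re u| + `|Im u|.
Proof. by rewrite /norm1 -lock. Qed.

Lemma Re_le_norm1 u : `|Re u| <= norm1 u.
Proof. by rewrite norm1E lerDl. Qed.

Lemma Im_le_norm1 u : `|Im u| <= norm1 u.
Proof. by rewrite norm1E lerDr. Qed.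

Lemma complex_eq u v : Re u = Re v -> Im u = Im v -> u = v.
Proof. by case: u v => [p q] [r s] /= -> ->. Qed.

Lemma ReM u v : Re (u * v) = Re u * Re v - Im u * Im v.
Proof. by case: u v => [p q] [r s]. Qed.

Lemma ImM u v : Im (u * v) = Re u * Im v + Im u * Re v.
Proof. by case: u v => [p q] [r s]. Qed.

Lemma ReD u v : Re (u + v) = Re u + Re v.
Proof. by case: u v => [p q] [r s]. Qed.

Lemma ImD u v : Im (u + v) = Im u + Im v.
Proof. by case: u v => [p q] [r s]. Qed.

Lemma ReN u : Re (- u) = - Re u.
Proof. by case: u. Qed.

Lemma ImN u : Im (- u) = - Im u.
Proof. by case: u. Qed.

Lemma norm1_ge0 u : 0 <= norm1 u.
Proof. by rewrite norm1E addr_ge0. Qed.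

Lemma norm1_0 : norm1 0 = 0.
Proof. by rewrite norm1E /= normr0 addr0. Qed.

Lemma norm1_eq0 u : norm1 u <= 0 -> u = 0.
Proof.
move=> H; have h1 := normr_ge0 (Re u); have h2 := normr_ge0 (Im u).
by apply: complex_eq => /=; apply/eqP; rewrite -normr_eq0; apply/eqP;
  move: H; rewrite norm1E; lra.
Qed.

Lemma norm1N u : norm1 (- u) = norm1 u.
Proof. by rewrite !norm1E ReN ImN !normrN. Qed.

Lemma norm1D u v : norm1 (u + v) <= norm1 u + norm1 v.
Proof. by rewrite !norm1E ReD ImD addrACA lerD// ler_normD. Qed.

Lemma norm1B u v : norm1 (u - v) <= norm1 u + norm1 v.
Proof. by rewrite (le_trans (norm1D _ _))// norm1N. Qed.

Lemma norm1C u v : norm1 (u - v) = norm1 (v - u).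
Proof. by rewrite -norm1N opprB. Qed.

Lemma norm1M u v : norm1 (u * v) <= norm1 u * norm1 v.
Proof.
rewrite !norm1E ReM ImM.
have := ler_normB (Re u * Re v) (Im u * Im v).
have := ler_normD (Re u * Im v) (Im u * Re v).
rewrite !normrM; nra.
Qed.

Lemma norm1_sum (n : nat) (F : 'I_n -> C) :
  norm1 (\sum_i F i) <= \sum_i norm1 (F i).
Proof.
elim/big_ind2: _ => //; first by rewrite norm1_0.
by move=> p q r s pq rs; rewrite (le_trans (norm1D _ _))// lerD.
Qed.

(** Translates hypotheses stated with the usual modulus into [norm1]; each of the two parts is at
    most the modulus. *)
Lemma norm1_le_norm u (d : R) : `|u| <= d%:C -> norm1 u <= 2 * d.
Proof.
rewrite normc_def lecR => H.
have h (p q : R) : Num.sqrt (p ^+ 2 + q ^+ 2) <= d -> `|p| <= d.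
  by move=> hd; rewrite -sqrtr_sqr (le_trans _ hd)// ler_wsqrtr// lerDl sqr_ge0.
have h1 := h _ _ H; move: H; rewrite addrC => /h h2.
by rewrite norm1E; lra.
Qed.

Lemma csqnorm1_le_norm u : csqnorm u <= norm1 u ^+ 2.
Proof.
rewrite /csqnorm norm1E -(real_normK (num_real (Re u))) -(real_normK (num_real (Im u))).
have := normr_ge0 (Re u); have := normr_ge0 (Im u); nra.
Qed.

Lemma norm1_csqnorm u : norm1 u ^+ 2 <= 2 * csqnorm u.
Proof.
rewrite /csqnorm norm1E -(real_normK (num_real (Re u))) -(real_normK (num_real (Im u))).
have := sqr_ge0 (`|Re u| - `|Im u|); nra.
Qed.

Lemma Re_cint t f : Re (cint t f) = rint t (fun x => Re (f x)).
Proof. by rewrite /cint ReD ReM /= mul0r mulr0 subr0 addr0. Qed.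

Lemma Im_cint t f : Im (cint t f) = rint t (fun x => Im (f x)).
Proof. by rewrite /cint ImD ImM /= !mul0r mul1r !add0r. Qed.

Definition cbmeas f := rbmeas (fun x => Re (f x)) /\ rbmeas (fun x => Im (f x)).

Lemma cL1_eq {f} g : (forall x, a <= x <= b -> f x = g x) -> cL1 f -> cL1 g.
Proof.
move=> fg [h1 h2]; split.
  by apply: rL1_eq h1 => x /fg ->.
by apply: rL1_eq h2 => x /fg ->.
Qed.

Lemma cL1D f g : cL1 f -> cL1 g -> cL1 (fun x => f x + g x).
Proof.
move=> [f1 f2] [g1 g2]; split.
  by apply: rL1_eq (rL1D _ _ _ _ _ f1 g1) => x _; rewrite ReD.
by apply: rL1_eq (rL1D _ _ _ _ _ f2 g2) => x _; rewrite ImD.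
Qed.

Lemma cL1N f : cL1 f -> cL1 (fun x => - f x).
Proof.
move=> [f1 f2]; split.
  by apply: rL1_eq (rL1N _ _ _ _ f1) => x _; rewrite ReN.
by apply: rL1_eq (rL1N _ _ _ _ f2) => x _; rewrite ImN.
Qed.

Lemma cL1B f g : cL1 f -> cL1 g -> cL1 (fun x => f x - g x).
Proof. by move=> fi /cL1N; exact: cL1D. Qed.

Lemma cL1M f g : cL1 f -> cbmeas g -> cL1 (fun x => f x * g x).
Proof.
move=> [f1 f2] [g1 g2]; split.
  apply: rL1_eq (rL1B _ _ _ _ _ (rL1M _ _ _ _ _ f1 g1) (rL1M _ _ _ _ _ f2 g2)).
  by move=> x _; rewrite ReM.
apply: rL1_eq (rL1D _ _ _ _ _ (rL1M _ _ _ _ _ f1 g2) (rL1M _ _ _ _ _ f2 g1)).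
by move=> x _; rewrite ImM.
Qed.

Lemma cbmeas_L1 f : cbmeas f -> cL1 f.
Proof. by move=> [/rbmeas_L1 f1 /rbmeas_L1 f2]. Qed.

Lemma cbmeas_cst c : cbmeas (fun=> c).
Proof. by split; exact: rbmeas_cst. Qed.

Lemma cL1Z c f : cL1 f -> cL1 (fun x => c * f x).
Proof.
by move=> /cL1M /(_ (cbmeas_cst c)); apply: cL1_eq => x _; rewrite mulrC.
Qed.

Lemma cbmeasD f g : cbmeas f -> cbmeas g -> cbmeas (fun x => f x + g x).
Proof.
move=> [f1 f2] [g1 g2]; split.
  have -> : (fun x => Re (f x + g x)) = (fun x => Re (f x) + Re (g x)).
    by apply/funext => x; rewrite ReD.
  exact: rbmeasD.
have -> : (fun x => Im (f x + g x)) = (fun x => Im (f x) + Im (g x)).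
  by apply/funext => x; rewrite ImD.
exact: rbmeasD.
Qed.

Lemma cbmeasM f g : cbmeas f -> cbmeas g -> cbmeas (fun x => f x * g x).
Proof.
move=> [f1 f2] [g1 g2]; split.
  have -> : (fun x => Re (f x * g x)) =
            (fun x => Re (f x) * Re (g x) + - (Im (f x) * Im (g x))).
    by apply/funext => x; rewrite ReM.
  by apply: rbmeasD; [exact: rbmeasM|apply: rbmeasN; exact: rbmeasM].
have -> : (fun x => Im (f x * g x)) =
          (fun x => Re (f x) * Im (g x) + Im (f x) * Re (g x)).
  by apply/funext => x; rewrite ImM.
by apply: rbmeasD; exact: rbmeasM.
Qed.

Lemma cbmeasZ c f : cbmeas f -> cbmeas (fun x => c * f x).
Proof. exact/cbmeasM/cbmeas_cst. Qed.

Lemma cbmeasB f g : cbmeas f -> cbmeas g -> cbmeas (fun x => f x - g x).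
Proof.
move=> fB gB; have -> : (fun x => f x - g x) = (fun x => f x + -1 * g x).
  by apply/funext => x; rewrite mulN1r.
by apply: cbmeasD => //; exact: cbmeasZ.
Qed.

Lemma rL1_norm1 f : cL1 f -> rL1 (fun x => norm1 (f x)).
Proof.
move=> [f1 f2]; have := rL1D _ _ _ _ _ (rL1_norm _ _ _ _ f1) (rL1_norm _ _ _ _ f2).
by apply: rL1_eq => x _; rewrite norm1E.
Qed.

Lemma rbmeas_norm1 f : cbmeas f -> rbmeas (fun x => norm1 (f x)).
Proof.
move=> [f1 f2]; have := rbmeasD _ _ _ _ _ (rbmeas_norm _ _ _ _ f1) (rbmeas_norm _ _ _ _ f2).
by congr rbmeas; apply/funext => x; rewrite norm1E.
Qed.

Lemma rbmeas_sum (m : nat) (F : nat -> R -> R) : (forall k, (k < m)%N -> rbmeas (F k)) ->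
  rbmeas (fun x => \sum_(k < m) F k x).
Proof.
elim: m => [_|m IH H].
  have -> : (fun x => \sum_(k < 0) F k x) = (fun=> 0).
    by apply/funext => x; rewrite big_ord0.
  exact: rbmeas_cst.
have -> : (fun x => \sum_(k < m.+1) F k x) = (fun x => \sum_(k < m) F k x + F m x).
  by apply/funext => x; rewrite big_ord_recr.
by apply: rbmeasD; [apply: IH => k /ltnW; exact: H|exact: H].
Qed.

Lemma cint_eq t f g : (forall x, a <= x <= t -> f x = g x) -> cint t f = cint t g.
Proof.
by move=> fg; apply: complex_eq; rewrite ?Re_cint ?Im_cint;
  apply: rint_eq => x /fg ->.
Qed.

Lemma ae_mono2 (P Q S : R -> Prop) : (forall x, P x -> Q x -> S x) ->
  {ae mu, forall x, P x} -> {ae mu, forall x, Q x} -> {ae mu, forall x, S x}.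
Proof.
move=> PQS aP aQ; apply: negligibleS (negligibleU aP aQ) => x /= nS.
have [Px|] := pselect (P x); last by left.
by right=> Qx; apply: nS; exact: PQS.
Qed.

Lemma ae_mono (P Q : R -> Prop) : (forall x, P x -> Q x) ->
  {ae mu, forall x, P x} -> {ae mu, forall x, Q x}.
Proof. by move=> PQ aP; apply: (ae_mono2 _ _ _ _ aP aP) => x Px _; exact: PQ. Qed.

Lemma cint_ae t f g : a <= t <= b -> cL1 f -> cL1 g -> ae_eq a b f g ->
  cint t f = cint t g.
Proof.
move=> /andP[at_ tb] [f1 f2] [g1 g2] fg.
have H (P Q : R -> R) : rL1 P -> rL1 Q ->
    {ae mu, forall x, a <= x <= b -> P x = Q x} -> rint t P = rint t Q.
  move=> Pi Qi PQ; congr fine; apply: ae_eq_integral => //.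
  - exact: (measurable_int mu (rL1_sub _ _ _ _ _ tb Pi)).
  - exact: (measurable_int mu (rL1_sub _ _ _ _ _ tb Qi)).
  - apply: (ae_mono _ _ _ PQ) => x H; rewrite mem_itv_set => /andP[ax xt].
    by rewrite H// ax (le_trans xt).
by apply: complex_eq; rewrite ?Re_cint ?Im_cint; apply: H => //;
  apply: (ae_mono _ _ _ fg) => x H xab; rewrite H.
Qed.

Lemma cintD t f g : t <= b -> cL1 f -> cL1 g ->
  cint t (fun x => f x + g x) = cint t f + cint t g.
Proof.
move=> tb [f1 f2] [g1 g2]; apply: complex_eq.
  rewrite ReD !Re_cint -(rintD _ _ b)//; apply: rint_eq => x _; exact: ReD.
rewrite ImD !Im_cint -(rintD _ _ b)//; apply: rint_eq => x _; exact: ImD.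
Qed.

Lemma cintZ t c f : t <= b -> cL1 f -> cint t (fun x => c * f x) = c * cint t f.
Proof.
move=> tb [f1 f2]; apply: complex_eq.
  rewrite ReM !Re_cint Im_cint -!(rintZ _ _ b)// -(rintB _ _ b)//; try exact: rL1Z.
  by apply: rint_eq => x _; exact: ReM.
rewrite ImM !Im_cint Re_cint -!(rintZ _ _ b)// -(rintD _ _ b)//; try exact: rL1Z.
by apply: rint_eq => x _; exact: ImM.
Qed.

Lemma cintN t f : t <= b -> cL1 f -> cint t (fun x => - f x) = - cint t f.
Proof.
move=> tb fi; rewrite -mulN1r -cintZ//; apply: cint_eq => x _.
by rewrite mulN1r.
Qed.

Lemma cintB t f g : t <= b -> cL1 f -> cL1 g ->
  cint t (fun x => f x - g x) = cint t f - cint t g.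
Proof. by move=> tb fi gi; rewrite cintD ?cintN//; exact: cL1N. Qed.

Lemma cint_start f : cint a f = 0.
Proof. by apply: complex_eq; rewrite ?Re_cint ?Im_cint rint_start. Qed.

Lemma cint_norm1 t f : a <= t <= b -> cL1 f ->
  norm1 (cint t f) <= rint t (fun x => norm1 (f x)).
Proof.
move=> /andP[at_ tb] [f1 f2]; rewrite norm1E Re_cint Im_cint.
under [leRHS]rint_eq => x _ do rewrite norm1E.
by rewrite (rintD _ _ b) ?lerD ?(rint_norm _ _ b)//; exact: rL1_norm.
Qed.

Lemma cint_norm1_le t f (g : R -> R) : a <= t <= b -> cL1 f -> rL1 g ->
  (forall x, a <= x <= b -> norm1 (f x) <= g x) -> norm1 (cint t f) <= rint t g.
Proof.
move=> tab fi gi fg; have /andP[at_ tb] := tab.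
rewrite (le_trans (cint_norm1 _ _ tab fi))// (rint_le _ _ b)//; first exact: rL1_norm1.
by move=> x /andP[ax xt]; rewrite fg// ax (le_trans xt).
Qed.

Lemma cint_bmeas f : cL1 f -> cbmeas (fun x => cint x f).
Proof.
move=> [f1 f2]; split.
  have -> : (fun x => Re (cint x f)) = (fun x => rint x (fun s => Re (f s))).
    by apply/funext => x; rewrite Re_cint.
  exact: rint_bmeas.
have -> : (fun x => Im (cint x f)) = (fun x => rint x (fun s => Im (f s))).
  by apply/funext => x; rewrite Im_cint.
exact: rint_bmeas.
Qed.

Lemma ACP z w : AC_with_deriv a b z w <->
  rAC (fun x => Re (z x)) (fun x => Re (w x)) /\
  rAC (fun x => Im (z x)) (fun x => Im (w x)).
Proof.
split=> [[[w1 w2] H]|[[w1 H1] [w2 H2]]].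
  split; split=> // x /H zx; first by rewrite -Re_cint -ReD -zx.
  by rewrite -Im_cint -ImD -zx.
split=> // x xab; apply: complex_eq; first by rewrite ReD Re_cint -H1.
by rewrite ImD Im_cint -H2.
Qed.

Lemma AC_bmeas z w : AC_with_deriv a b z w -> cbmeas z.
Proof. by move=> /ACP[/rAC_bmeas H1 /rAC_bmeas H2]; split; [exact: H1|exact: H2]. Qed.

(** The operator graph fixes derivatives only almost everywhere; this exchanges a representative for
    the right-hand side of the system. *)
Lemma AC_deriv_ae z w w' : AC_with_deriv a b z w -> cL1 w' -> ae_eq a b w w' ->
  AC_with_deriv a b z w'.
Proof.
by move=> [wi H] wi' ww'; split=> // x xab; rewrite H// (cint_ae _ w w').
Qed.

Lemma AC_deriv_eq z w w' : AC_with_deriv a b z w ->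
  (forall x, a <= x <= b -> w x = w' x) -> AC_with_deriv a b z w'.
Proof.
move=> [wi H] ww'; split; first exact: cL1_eq wi.
move=> x xab; rewrite H//; congr (_ + _); apply: cint_eq => s /andP[as_ sx].
by apply: ww'; rewrite as_ (le_trans sx)//; case/andP: xab.
Qed.

Lemma AC_D z w z' w' : AC_with_deriv a b z w -> AC_with_deriv a b z' w' ->
  AC_with_deriv a b (fun x => z x + z' x) (fun x => w x + w' x).
Proof.
move=> [wi H] [wi' H']; split; first exact: cL1D.
move=> x xab; have /andP[_ xb] := xab.
by rewrite cintD// H// H'// addrACA.
Qed.

Lemma AC_Z c z w : AC_with_deriv a b z w ->
  AC_with_deriv a b (fun x => c * z x) (fun x => c * w x).
Proof.
move=> [wi H]; split; first exact: cL1Z.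
by move=> x xab; have /andP[_ xb] := xab; rewrite cintZ// H// mulrDr.
Qed.

Lemma AC_cint f : cL1 f -> AC_with_deriv a b (fun x => cint x f) f.
Proof. by move=> fi; split=> // x _; rewrite cint_start add0r. Qed.

Lemma rAC_add (F f G g : R -> R) : rAC F f -> rAC G g ->
  rAC (fun x => F x + G x) (fun x => f x + g x).
Proof.
move=> [fi H] [gi H']; split; first exact: rL1D.
move=> x xab; have /andP[_ xb] := xab.
by rewrite (rintD _ _ b)// H// H'// addrACA.
Qed.

Lemma rAC_opp (F f : R -> R) : rAC F f -> rAC (fun x => - F x) (fun x => - f x).
Proof.
move=> [fi H]; split; first exact: rL1N.
move=> x xab; have /andP[_ xb] := xab.
by rewrite (rintN _ _ b)// H// opprD.
Qed.

Lemma AC_mul z w z' w' : AC_with_deriv a b z w -> AC_with_deriv a b z' w' ->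
  AC_with_deriv a b (fun x => z x * z' x) (fun x => w x * z' x + z x * w' x).
Proof.
move=> /ACP[z1 z2] /ACP[y1 y2]; apply/ACP.
have H11 := rAC_mul _ _ _ leab _ _ _ _ z1 y1.
have H22 := rAC_mul _ _ _ leab _ _ _ _ z2 y2.
have H12 := rAC_mul _ _ _ leab _ _ _ _ z1 y2.
have H21 := rAC_mul _ _ _ leab _ _ _ _ z2 y1.
split.
  have [i H] := rAC_add _ _ _ _ H11 (rAC_opp _ _ H22); split.
    by apply: rL1_eq i => x _; rewrite ReD !ReM; ring.
  move=> x xab; rewrite !ReM H//; congr (_ + _); apply: rint_eq => s _.
  by rewrite ReD !ReM; ring.
have [i H] := rAC_add _ _ _ _ H12 H21; split.
  by apply: rL1_eq i => x _; rewrite ImD !ImM; ring.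
move=> x xab; rewrite !ImM H//; congr (_ + _); apply: rint_eq => s _.
by rewrite ImD !ImM; ring.
Qed.

End ComplexCalculus.

(** * First-order systems with integrable coefficients *)

Section Systems.
Variables (R : realType) (a b : R).
Hypothesis leab : a <= b.
Local Notation C := R[i].
Local Notation rL1 := (rL1 R a b).
Local Notation rbmeas := (rbmeas R a b).
Local Notation cbmeas := (cbmeas R a b).
Local Notation rint := (rint R a).
Local Notation norm1 := (norm1 R).
Local Notation cL1 := (cL1 a b).
Local Notation cint := (cint a).

Definition vec_norm1 (m : nat) (p : nat -> C) : R := \sum_(j < m) norm1 (p j).

Lemma vec_norm1_ge0 m p : 0 <= vec_norm1 m p.
Proof. by apply: sumr_ge0 => j _; exact: norm1_ge0. Qed.

Lemma norm1_le_vec_norm1 m p k : (k < m)%N -> norm1 (p k) <= vec_norm1 m p.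
Proof.
move=> km; rewrite /vec_norm1 (bigD1 (Ordinal km))//= lerDl.
by apply: sumr_ge0 => j _; exact: norm1_ge0.
Qed.

Lemma vec_norm1_le m p (E : R) : (forall k, (k < m)%N -> norm1 (p k) <= E) ->
  vec_norm1 m p <= m%:R * E.
Proof.
move=> H; rewrite (@le_trans _ _ (\sum_(j < m) E))//.
  by apply: ler_sum => j _; exact: H.
by rewrite sumr_const card_ord mulr_natl.
Qed.

Lemma vec_norm1_eq m p q : (forall k, (k < m)%N -> p k = q k) -> vec_norm1 m p = vec_norm1 m q.
Proof. by move=> H; apply: eq_bigr => j _; rewrite H. Qed.

Lemma vec_norm1_le_add m p q r : (forall k, (k < m)%N -> norm1 (p k) <= norm1 (q k) + norm1 (r k)) ->
  vec_norm1 m p <= vec_norm1 m q + vec_norm1 m r.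
Proof. by move=> H; rewrite /vec_norm1 -big_split/=; apply: ler_sum => j _; exact: H. Qed.

Lemma rbmeas_vec_norm1 m (z : nat -> R -> C) : (forall k, (k < m)%N -> cbmeas (z k)) ->
  rbmeas (fun x => vec_norm1 m (fun k => z k x)).
Proof.
by move=> zB; apply: (rbmeas_sum _ _ _ _ (fun k x => norm1 (z k x))) => k /zB; exact: rbmeas_norm1.
Qed.

Section System.
Variables (m : nat) (h : R -> R).
Hypothesis hi : rL1 h.
Hypothesis h0 : forall x, a <= x <= b -> 0 <= h x.

(** All [m] components obey the same estimate, so summing them multiplies the kernel by [m]. *)
Let mh := fun x => m%:R * h x.

Let mhi : rL1 mh.
Proof. exact: rL1Z. Qed.

Let mh0 x : a <= x <= b -> 0 <= mh x.
Proof. by move=> xab; rewrite mulr_ge0// h0. Qed.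

Let rint_mh (d : nat -> R -> C) x : a <= x <= b ->
  (forall k, (k < m)%N -> cbmeas (d k)) ->
  m%:R * rint x (fun s => h s * vec_norm1 m (fun j => d j s)) =
  rint x (fun s => mh s * vec_norm1 m (fun j => d j s)).
Proof.
move=> /andP[_ xb] dB; rewrite -(rintZ _ _ b)//.
  by apply: rint_eq => s _; rewrite mulrA.
by apply: rL1M => //; exact: rbmeas_vec_norm1.
Qed.

Lemma system_gronwall : exists2 K : R, 0 <= K & forall (d : nat -> R -> C) E,
  (forall k, (k < m)%N -> cbmeas (d k)) -> 0 <= E ->
  (forall k x, (k < m)%N -> a <= x <= b ->
     norm1 (d k x) <= E + rint x (fun s => h s * vec_norm1 m (fun j => d j s))) ->
  forall x, a <= x <= b -> vec_norm1 m (fun j => d j x) <= K * E.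
Proof.
have [K K0 H] := gronwall _ _ _ leab mh mhi mh0.
exists (K * m%:R); first by rewrite mulr_ge0.
move=> d E dB E0 dE x xab; rewrite -mulrA.
apply: (H (fun x => vec_norm1 m (fun j => d j x))) => //.
- exact: rbmeas_vec_norm1.
- by rewrite mulr_ge0.
- move=> y yab; rewrite -rint_mh// -mulrDr.
  by apply: vec_norm1_le => k km; exact: dE.
Qed.

(** Carathéodory conditions: an integrable Lipschitz constant, and integrability after substituting
    bounded measurable functions. The Lipschitz bound also makes [f] depend only on the first [m]
    entries of the sequence. *)
Variable f : nat -> R -> (nat -> C) -> C.
Hypothesis f_lip : forall k x p q, (k < m)%N -> a <= x <= b ->
  norm1 (f k x p - f k x q) <= h x * vec_norm1 m (fun j => p j - q j).
Hypothesis f_L1 : forall z : nat -> R -> C, (forall k, (k < m)%N -> cbmeas (z k)) ->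
  forall k, (k < m)%N -> cL1 (fun x => f k x (fun j => z j x)).

Fixpoint picard (v : nat -> C) (n k : nat) (x : R) : C :=
  if n is n'.+1 then v k + cint x (fun s => f k s (fun j => picard v n' j s))
  else v k.

Lemma picard_bmeas v n k : (k < m)%N -> cbmeas (picard v n k).
Proof.
elim: n k => [|n IH] k km; first exact: cbmeas_cst.
apply: cbmeasD; first exact: cbmeas_cst.
by apply: cint_bmeas => //; apply: f_L1.
Qed.

Lemma cint_f_dist (y z : nat -> R -> C) k x : (k < m)%N -> a <= x <= b ->
  (forall k, (k < m)%N -> cbmeas (y k)) -> (forall k, (k < m)%N -> cbmeas (z k)) ->
  norm1 (cint x (fun s => f k s (fun j => y j s)) -
      cint x (fun s => f k s (fun j => z j s))) <=
  rint x (fun s => h s * vec_norm1 m (fun j => y j s - z j s)).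
Proof.
move=> km xab yB zB; have /andP[_ xb] := xab.
have yi := f_L1 _ yB _ km; have zi := f_L1 _ zB _ km.
rewrite -(cintB _ _ b)//; apply: (cint_norm1_le _ _ b) => //; first exact: cL1B.
  apply: rL1M => //; apply: (rbmeas_vec_norm1 _ (fun j s => y j s - z j s)) => j jm.
  by apply: cbmeasB; [exact: yB|exact: zB].
by move=> s sab; exact: f_lip.
Qed.

(** Thanks to the weight, Picard increments are summable on all of [a, b] at once, so local
    solutions need not be continued. The limit is measurable as a pointwise limit and stays within a
    fixed distance of iterate 0; the Lipschitz bound then carries the integral equation to it. *)
Lemma ivp_exists (v : nat -> C) : exists Z : nat -> R -> C,
  (forall k, (k < m)%N -> Z k a = v k) /\
  forall k, (k < m)%N -> AC_with_deriv a b (Z k) (fun x => f k x (fun j => Z j x)).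
Proof.
pose Zn := picard v; have ZnB n k : (k < m)%N -> cbmeas (Zn n k) by exact: picard_bmeas.
have [K K0 HK] := volterra_decay _ _ _ leab mh mhi mh0.
pose D n x := vec_norm1 m (fun j => Zn n.+1 j x - Zn n j x).
have DB n : rbmeas (D n).
  apply: (rbmeas_vec_norm1 _ (fun j x => Zn n.+1 j x - Zn n j x)) => k km.
  by apply: cbmeasB; exact: ZnB.
have [B HB] := (DB 0%N).2.
have B0 : 0 <= B by rewrite (le_trans _ (HB a _))// lexx.
have Ddecay : forall n x, a <= x <= b -> D n x <= K * B / 2 ^+ n.
  apply: HK => // [x xab|n x xab]; first by rewrite (le_trans (ler_norm _))// HB.
  rewrite -(rint_mh (fun j s => Zn n.+1 j s - Zn n j s))// => [|k km]; last first.
    by apply: cbmeasB; exact: ZnB.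
  apply: vec_norm1_le => k km.
  rewrite [Zn n.+2 _ _]/= [Zn n.+1 k _]/= opprD addrACA subrr add0r.
  by apply: (cint_f_dist (Zn n.+1) (Zn n)) => // j; exact: ZnB.
pose M := K * B.
have Zstep k x n : (k < m)%N -> a <= x <= b -> norm1 (Zn n.+1 k x - Zn n k x) <= M / 2 ^+ n.
  move=> km xab; apply: le_trans (Ddecay n x xab).
  exact: (norm1_le_vec_norm1 _ (fun j => Zn n.+1 j x - Zn n j x)).
(* Limits are taken pointwise, with value 0 outside the range. The 4 is the 2 of [geometric_limit],
   once for the real and once for the imaginary part. *)
have /choice[Z HZ] (kx : nat * R) : exists l : C, (kx.1 < m)%N -> a <= kx.2 <= b ->
    forall n, norm1 (l - Zn n kx.1 kx.2) <= 4 * M / 2 ^+ n.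
  case: kx => k x /=.
  have [km|nkm] := boolP (k < m)%N; last by exists 0.
  have [xab|nxab] := boolP (a <= x <= b); last by exists 0.
  have hr n : `|complex.Re (Zn n.+1 k x) - complex.Re (Zn n k x)| <= M / 2 ^+ n.
    by rewrite -ReN -ReD (le_trans _ (Zstep k x n km xab))// Re_le_norm1.
  have hi_ n : `|complex.Im (Zn n.+1 k x) - complex.Im (Zn n k x)| <= M / 2 ^+ n.
    by rewrite -ImN -ImD (le_trans _ (Zstep k x n km xab))// Im_le_norm1.
  have [p Hp] := geometric_limit _ _ _ hr; have [q Hq] := geometric_limit _ _ _ hi_.
  exists (Complex p q) => _ _ n; rewrite norm1E ReD ImD ReN ImN /=.
  by have := Hp n; have := Hq n; rewrite -!mulrA; lra.
pose z k x := Z (k, x).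
have zlim k x n : (k < m)%N -> a <= x <= b -> norm1 (z k x - Zn n k x) <= 4 * M / 2 ^+ n.
  by move=> km xab; exact: (HZ (k, x)).
have M0 : 0 <= M by rewrite mulr_ge0.
have cvg (u : nat -> R) (l : R) : (forall n, `|l - u n| <= 4 * M / 2 ^+ n) -> u @ \oo --> l.
  move=> ul; apply/cvgrPdist_le => e e0.
  exists (Num.truncn (4 * M / e)).+1 => // n /= ltn.
  rewrite (le_trans (ul n))// ler_pdivrMr ?exprn_gt0// -ler_pdivrMl// mulrC.
  rewrite (le_trans (ltW (truncnS_gt _)))// -natrX ler_nat (leq_trans ltn)//.
  by rewrite ltnW// ltn_expl.
have zB k : (k < m)%N -> cbmeas (z k).
  move=> km; have [[mr [Br HBr]] [mi [Bi HBi]]] := ZnB 0%N k km.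
  have bound0 x : a <= x <= b -> norm1 (z k x - Zn 0%N k x) <= 4 * M.
    by move=> /(zlim k x 0%N km); rewrite expr0 divr1.
  split; split.
  - apply: (@measurable_fun_cvg _ _ _ `[a, b] (fun n x => complex.Re (Zn n k x)) _) => [n|x].
      by have [[]] := ZnB n k km.
    rewrite mem_itv_set => xab; apply: cvg => n.
    by rewrite -ReN -ReD (le_trans _ (zlim k x n km xab))// Re_le_norm1.
  - exists (Br + 4 * M) => x xab; have := bound0 x xab.
    rewrite norm1E ReD ReN => H; have := HBr x xab.
    have := ler_normD (complex.Re (Zn 0%N k x)) (complex.Re (z k x) - complex.Re (Zn 0%N k x)).
    rewrite addrC subrK; have := normr_ge0 (complex.Im (z k x - Zn 0%N k x)); lra.
  - apply: (@measurable_fun_cvg _ _ _ `[a, b] (fun n x => complex.Im (Zn n k x)) _) => [n|x].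
      by have [_ []] := ZnB n k km.
    rewrite mem_itv_set => xab; apply: cvg => n.
    by rewrite -ImN -ImD (le_trans _ (zlim k x n km xab))// Im_le_norm1.
  - exists (Bi + 4 * M) => x xab; have := bound0 x xab.
    rewrite norm1E ImD ImN => H; have := HBi x xab.
    have := ler_normD (complex.Im (Zn 0%N k x)) (complex.Im (z k x) - complex.Im (Zn 0%N k x)).
    rewrite addrC subrK; have := normr_ge0 (complex.Re (z k x - Zn 0%N k x)); lra.
have zeq k x : (k < m)%N -> a <= x <= b ->
    z k x = v k + cint x (fun s => f k s (fun j => z j s)).
  move=> km xab; apply/eqP; rewrite -subr_eq0; apply/eqP/norm1_eq0.
  have /andP[ax xb] := xab.
  (* The residual is compared at stage n: [4 * M] bounds the distance from [z] to iterate n+1, the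
     rest the Lipschitz error between iterate n and [z]. *)
  apply: (le_geometric _ _ _ (4 * M + m%:R * (4 * M) * rint x h)) => n; rewrite add0r.
  have -> : z k x - (v k + cint x (fun s => f k s (fun j => z j s))) =
            (z k x - Zn n.+1 k x) +
            (cint x (fun s => f k s (fun j => Zn n j s)) -
             cint x (fun s => f k s (fun j => z j s))).
    by rewrite /Zn /=; ring.
  rewrite (le_trans (norm1D _ _ _))// mulrDl lerD//.
    rewrite (le_trans (zlim _ _ _ km xab))// exprS invfM.
    have : 0 <= (2 ^+ n)^-1 :> R by rewrite invr_ge0 exprn_ge0.
    by move=> i0; rewrite ler_wpM2l ?mulr_ge0// ler_piMl//; lra.
  rewrite (le_trans (cint_f_dist _ _ _ _ km xab (ZnB n) zB))//.
  have -> : m%:R * (4 * M) * rint x h / 2 ^+ n = (m%:R * (4 * M / 2 ^+ n)) * rint x h.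
    by ring.
  rewrite -(rintZ _ _ b)//; apply: (rint_le _ _ b) => //; [|exact: rL1Z|].
    apply: rL1M => //; apply: (rbmeas_vec_norm1 _ (fun j s => Zn n j s - z j s)) => j jm.
    by apply: cbmeasB; [exact: ZnB|exact: zB].
  move=> s /andP[as_ sx]; have sab : a <= s <= b by rewrite as_ (le_trans sx).
  rewrite mulrC ler_wpM2r ?h0//; apply: vec_norm1_le => j jm.
  by rewrite norm1C; exact: zlim.
exists z; split=> [k km|k km].
  by rewrite zeq ?lexx// cint_start addr0.
split=> [|x xab]; first exact: f_L1.
by rewrite zeq// [z k a]zeq ?lexx// cint_start addr0.
Qed.

End System.
End Systems.

(** * The system of quasi-derivatives *)

Section QuasiSystem.
Variables (R : realType) (a b : R).
Hypothesis leab : a <= b.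
Local Notation C := R[i].
Local Notation rL1 := (rL1 R a b).
Local Notation rbmeas := (rbmeas R a b).
Local Notation cbmeas := (cbmeas R a b).
Local Notation rint := (rint R a).
Local Notation norm1 := (norm1 R).
Local Notation cL1 := (cL1 a b).
Local Notation cint := (cint a).
Local Notation vec_norm1 := (vec_norm1 R).

(** Replaces solving [S <= S0 + S / 2] for the supremum [S] of [F]: starting from any finite bound,
    n rounds leave [2 * S0 + B / 2 ^+ n]. *)
Lemma absorb (F : R -> R) (S0 : R) : rbmeas F -> 0 <= S0 ->
  (forall S, 0 <= S -> (forall x, a <= x <= b -> F x <= S) ->
     forall x, a <= x <= b -> F x <= S0 + S / 2) ->
  forall x, a <= x <= b -> F x <= 2 * S0.
Proof.
move=> [_ [B HB]] S00 H x xab.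
have B0 : 0 <= B by rewrite (le_trans _ (HB a _))// lexx.
apply: (le_geometric _ _ _ B) => n; elim: n x xab => [|n IH] x xab.
  rewrite expr0 divr1 (le_trans (ler_norm _))// (le_trans (HB x xab))//.
  by rewrite lerDr mulr_ge0.
apply: le_trans (H _ _ IH x xab) _.
  by rewrite addr_ge0 ?mulr_ge0 ?divr_ge0 ?exprn_ge0.
by rewrite exprS invfM; lra.
Qed.

Variable m : nat.
Hypothesis m3 : (2 < m)%N.
Local Notation c := ('i ^- m : C).

(* The k-th component of the first-order system [Z' = qrhs Z] satisfied by the
   quasi-derivatives of a solution of [L y = lam y + g]. *)
Definition qrhs (Q : R -> C) (lam : C) (g : R -> C) (k : nat) (x : R)
    (p : nat -> C) : C :=
  if (k.+2 < m)%N then p k.+1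
  else if k.+2 == m then p k.+1 - c * Q x * p 0%N
  else c * Q x * p 1%N + c * (lam * p 0%N + g x).

Definition qsol (Q : R -> C) (lam : C) (g : R -> C) (z : nat -> R -> C) := forall k, (k < m)%N ->
  AC_with_deriv a b (z k) (fun x => qrhs Q lam g k x (fun j => z j x)).

Definition qlip (Q : R -> C) (lam : C) (x : R) : R := 1 + norm1 c * norm1 (Q x) + norm1 c * norm1 lam.

Lemma qlip_ge0 Q lam x : a <= x <= b -> 0 <= qlip Q lam x.
Proof. by move=> _; rewrite !addr_ge0 ?mulr_ge0// norm1_ge0. Qed.

Lemma qlip_L1 Q lam : cL1 Q -> rL1 (qlip Q lam).
Proof.
move=> Qi; apply: rL1D; last exact/rbmeas_L1/rbmeas_cst.
by apply: rL1D; [exact/rbmeas_L1/rbmeas_cst|apply: rL1Z; exact: rL1_norm1].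
Qed.

Lemma m_pos : (0 < m)%N. Proof. exact: leq_trans m3. Qed.
Lemma m_gt1 : (1 < m)%N. Proof. exact: leq_trans m3. Qed.

Lemma qrhs_lip Q lam g k x p q : (k < m)%N -> a <= x <= b ->
  norm1 (qrhs Q lam g k x p - qrhs Q lam g k x q) <=
  qlip Q lam x * vec_norm1 m (fun j => p j - q j).
Proof.
move=> km _; set S := vec_norm1 m _.
have S0 : 0 <= S by exact: vec_norm1_ge0.
have HS j : (j < m)%N -> norm1 (p j - q j) <= S by exact: (norm1_le_vec_norm1 _ _ (fun j => p j - q j)).
clearbody S.
have nc := norm1_ge0 _ c; have nQ := norm1_ge0 _ (Q x); have nl := norm1_ge0 _ lam.
have cQ0 : 0 <= norm1 c * norm1 (Q x) by rewrite mulr_ge0.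
have cl0 : 0 <= norm1 c * norm1 lam by rewrite mulr_ge0.
have cQS := mulr_ge0 cQ0 S0; have clS := mulr_ge0 cl0 S0.
have HQ j : (j < m)%N -> norm1 (c * Q x * (p j - q j)) <= norm1 c * norm1 (Q x) * S.
  move=> jm; rewrite (le_trans (norm1M _ _ _))//.
  by apply: ler_pM; rewrite ?norm1_ge0// ?norm1M ?HS.
have -> : qlip Q lam x * S = S + norm1 c * norm1 (Q x) * S + norm1 c * norm1 lam * S.
  by rewrite /qlip; ring.
rewrite /qrhs; case: ifP => [k2|k2].
  by have := HS _ (leq_trans (leqnSn _) k2); lra.
case: eqP => [k2e|k2n].
  have -> : p k.+1 - c * Q x * p 0%N - (q k.+1 - c * Q x * q 0%N) =
            (p k.+1 - q k.+1) - c * Q x * (p 0%N - q 0%N) by ring.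
  have h1 : norm1 (p k.+1 - q k.+1) <= S by apply: HS; rewrite -k2e.
  have h2 := HQ _ m_pos.
  by apply: le_trans (norm1B _ _ _) _; lra.
have -> : c * Q x * p 1%N + c * (lam * p 0%N + g x) -
          (c * Q x * q 1%N + c * (lam * q 0%N + g x)) =
          c * Q x * (p 1%N - q 1%N) + c * lam * (p 0%N - q 0%N) by ring.
apply: le_trans (norm1D _ _ _) _.
have h1 := HQ _ m_gt1.
have h2 : norm1 (c * lam * (p 0%N - q 0%N)) <= norm1 c * norm1 lam * S.
  rewrite (le_trans (norm1M _ _ _))//.
  by apply: ler_pM; rewrite ?norm1_ge0// ?norm1M// HS// m_pos.
lra.
Qed.

Lemma qrhs_L1 Q lam g : cL1 Q -> cL1 g ->
  forall z : nat -> R -> C, (forall k, (k < m)%N -> cbmeas (z k)) ->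
  forall k, (k < m)%N -> cL1 (fun x => qrhs Q lam g k x (fun j => z j x)).
Proof.
move=> Qi gi z zB k km; rewrite /qrhs.
have QzL1 j : (j < m)%N -> cL1 (fun x => c * Q x * z j x).
  by move=> jm; apply: cL1M; [exact: cL1Z|exact: zB].
have [k2|k2] := ltnP k.+2 m; first by apply/cbmeas_L1/zB; apply: leq_trans k2.
have [k2e|k2n] := eqVneq k.+2 m.
  apply: cL1B; last exact/QzL1/m_pos.
  by apply/cbmeas_L1/zB; rewrite -k2e.
apply: cL1D; first exact/QzL1/m_gt1.
apply/cL1Z/cL1D => //; apply/cL1Z/cbmeas_L1/zB; exact: m_pos.
Qed.

Lemma qsol_bmeas Q lam g z : qsol Q lam g z -> forall k, (k < m)%N -> cbmeas (z k).
Proof. by move=> H k /H /(AC_bmeas _ _ _ leab). Qed.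

Lemma qsol_exists Q lam g : cL1 Q -> cL1 g -> forall v : nat -> C,
  exists Z, (forall k, (k < m)%N -> Z k a = v k) /\ qsol Q lam g Z.
Proof.
move=> Qi gi; apply: (ivp_exists _ _ _ leab _ (qlip Q lam)).
- exact: qlip_L1.
- exact: qlip_ge0.
- exact: qrhs_lip.
- exact: qrhs_L1.
Qed.

Lemma cint_qrhs_dist Q lam g y z k x : cL1 Q -> cL1 g ->
  (k < m)%N -> a <= x <= b ->
  (forall k, (k < m)%N -> cbmeas (y k)) -> (forall k, (k < m)%N -> cbmeas (z k)) ->
  norm1 (cint x (fun s => qrhs Q lam g k s (fun j => y j s)) -
      cint x (fun s => qrhs Q lam g k s (fun j => z j s))) <=
  rint x (fun s => qlip Q lam s * vec_norm1 m (fun j => y j s - z j s)).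
Proof.
move=> Qi gi; apply: cint_f_dist; first exact: qlip_L1.
  exact: qrhs_lip.
exact: qrhs_L1.
Qed.

Lemma qrhs_lin Q lam g g' u k x p q :
  qrhs Q lam (fun x => g x + u * g' x) k x (fun j => p j + u * q j) =
  qrhs Q lam g k x p + u * qrhs Q lam g' k x q.
Proof. by rewrite /qrhs; case: ifP => // _; case: ifP => _; ring. Qed.

Lemma qsol_lin Q lam g g' u z z' : qsol Q lam g z -> qsol Q lam g' z' ->
  qsol Q lam (fun x => g x + u * g' x) (fun k x => z k x + u * z' k x).
Proof.
move=> H H' k km.
apply: AC_deriv_eq (AC_D _ _ _ _ _ _ _ (H k km) (AC_Z _ _ _ u _ _ (H' k km))) _.
by move=> x _; rewrite qrhs_lin.
Qed.

Lemma qsol_eqg Q lam g g' z : (forall x, g x = g' x) ->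
  qsol Q lam g z -> qsol Q lam g' z.
Proof. by move=> /funext ->. Qed.

Lemma qsol_sub Q lam g z z' : qsol Q lam g z -> qsol Q lam g z' ->
  qsol Q lam (fun=> 0) (fun k x => z k x - z' k x).
Proof.
move=> H H'; have := qsol_lin _ _ _ _ (-1) _ _ H H'.
have -> : (fun k x => z k x + -1 * z' k x) = (fun k x => z k x - z' k x).
  by apply/funext => k; apply/funext => x; rewrite mulN1r.
by apply: qsol_eqg => x; rewrite mulN1r subrr.
Qed.

Lemma qsol_zero Q lam : qsol Q lam (fun=> 0) (fun _ _ => 0).
Proof.
move=> k km.
have -> : (fun x => qrhs Q lam (fun=> 0) k x (fun=> 0)) = (fun=> 0).
  by apply/funext => x; rewrite /qrhs; case: ifP => // _; case: ifP => _; ring.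
split=> [|x /andP[ax _]]; first exact/cbmeas_L1/cbmeas_cst.
by rewrite add0r; apply: complex_eq; rewrite ?Re_cint ?Im_cint rint_cst// mul0r.
Qed.

Lemma qsol_sum Q lam (n : nat) (v : nat -> C) (Y : nat -> nat -> R -> C) :
  (forall j, (j < n)%N -> qsol Q lam (fun=> 0) (Y j)) ->
  qsol Q lam (fun=> 0) (fun k x => \sum_(j < n) v j * Y j k x).
Proof.
elim: n => [_|n IH H].
  have -> : (fun k x => \sum_(j < 0) v j * Y j k x) = (fun _ _ => 0).
    by apply/funext => k; apply/funext => x; rewrite big_ord0.
  exact: qsol_zero.
have -> : (fun k x => \sum_(j < n.+1) v j * Y j k x) =
          (fun k x => \sum_(j < n) v j * Y j k x + v n * Y n k x).
  by apply/funext => k; apply/funext => x; rewrite big_ord_recr.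
have := qsol_lin _ _ _ _ (v n) _ _ (IH (fun j jn => H j (ltnW jn))) (H n (ltnSn _)).
by apply: qsol_eqg => x; rewrite mulr0 addr0.
Qed.

Lemma qsol_bound Q lam : cL1 Q -> exists2 K : R, 0 <= K & forall g z, cL1 g ->
  qsol Q lam g z -> forall x, a <= x <= b ->
  vec_norm1 m (fun k => z k x) <= K * (vec_norm1 m (fun k => z k a) + rint b (fun s => norm1 (g s))).
Proof.
move=> Qi.
have [K K0 HK] := system_gronwall _ _ _ leab m _ (qlip_L1 Q lam Qi) (qlip_ge0 Q lam).
have nc := norm1_ge0 _ c.
exists (K * (1 + norm1 c)); first by rewrite mulr_ge0// addr_ge0.
move=> g z gi zs.
have I0 : 0 <= rint b (fun s => norm1 (g s)).
  by apply: (rint_ge0 _ _ b) => // [|x _]; [exact: rL1_norm1|exact: norm1_ge0].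
have v0 := vec_norm1_ge0 _ m (fun k => z k a).
have zB := qsol_bmeas _ _ _ _ zs.
have oB k : (k < m)%N -> cbmeas ((fun _ _ => 0) k) by move=> _; exact: cbmeas_cst.
move=> x xab; rewrite -mulrA.
apply: le_trans (HK z (vec_norm1 m (fun k => z k a) + norm1 c * rint b (fun s => norm1 (g s))) zB _ _ x xab) _.
- by rewrite addr_ge0 ?mulr_ge0.
- move=> k y km yab; have /andP[ay yb] := yab.
  have [di ->] := zs k km; last exact: yab.
  rewrite (le_trans (norm1D _ _ _))// -addrA lerD//.
    exact: (norm1_le_vec_norm1 _ _ (fun k => z k a)).
  have oi := qrhs_L1 Q lam g Qi gi _ oB k km.
  (* At the zero vector the right-hand side is [c * g x] in the last component and 0 elsewhere; the
     remaining difference is controlled by [qlip]. *)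
  have -> : cint y (fun x => qrhs Q lam g k x (fun j => z j x)) =
      cint y (fun x => qrhs Q lam g k x (fun=> 0)) +
      (cint y (fun x => qrhs Q lam g k x (fun j => z j x)) -
       cint y (fun x => qrhs Q lam g k x (fun=> 0))) by rewrite addrC subrK.
  rewrite (le_trans (norm1D _ _ _))//; apply: lerD.
    have cgi : rL1 (fun s => norm1 c * norm1 (g s)) by apply: rL1Z; exact: rL1_norm1.
    apply: (@le_trans _ _ (rint y (fun s => norm1 c * norm1 (g s)))).
      apply: (cint_norm1_le _ _ b) => // s _; rewrite /qrhs.
      case: ifP => _; first by rewrite norm1_0 mulr_ge0 ?norm1_ge0.
      case: ifP => _; first by rewrite mulr0 subr0 norm1_0 mulr_ge0 ?norm1_ge0.
      by rewrite !mulr0 !add0r norm1M.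
    rewrite -(rintZ _ _ b)//; last exact: rL1_norm1.
    by apply: (rint_mono _ _ b) => // s _; rewrite mulr_ge0 ?norm1_ge0.
  apply: le_trans (cint_qrhs_dist Q lam g z (fun _ _ => 0) k y Qi gi km yab zB oB) _.
  rewrite le_eqVlt; apply/orP; left; apply/eqP.
  by apply: rint_eq => s _; congr (_ * _); apply: vec_norm1_eq => j _; rewrite subr0.
- apply: ler_wpM2l => //; nra.
Qed.

Lemma by_parts P p z w x : AC_with_deriv a b P p -> AC_with_deriv a b z w ->
  P a = 0 -> a <= x <= b ->
  cint x (fun s => p s * z s) = P x * z x - cint x (fun s => P s * w s).
Proof.
move=> HP Hz Pa xab; have /andP[_ xb] := xab.
have pzi : cL1 (fun s => p s * z s) by apply: cL1M; [exact: HP.1|exact: AC_bmeas Hz].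
have Pwi : cL1 (fun s => P s * w s).
  apply: cL1_eq (cL1M _ _ _ _ _ Hz.1 (AC_bmeas _ _ _ leab _ _ HP)) => s _.
  by rewrite mulrC.
have [_ H] := AC_mul _ _ _ leab _ _ _ _ HP Hz.
by rewrite H// Pa mul0r add0r (cintD _ _ b)// addrK.
Qed.

(** The point is that no norm of [p] survives: the small [d] multiplies sup |z| and an L_1 majorant
    [W] of the derivative of [z]. *)
Lemma by_parts_bound P p z w (d S : R) (W : R -> R) x :
  AC_with_deriv a b P p -> AC_with_deriv a b z w -> rL1 W ->
  P a = 0 -> 0 <= d -> 0 <= S -> (forall s, a <= s <= b -> norm1 (P s) <= d) ->
  (forall s, a <= s <= b -> norm1 (z s) <= S) ->
  (forall s, a <= s <= b -> norm1 (w s) <= W s) -> a <= x <= b ->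
  norm1 (cint x (fun s => p s * z s)) <= d * (S + rint b W).
Proof.
move=> HP Hz Wi Pa d0 S0 Pd zS wW xab; have /andP[ax xb] := xab.
rewrite (by_parts P p z w)// (le_trans (norm1B _ _ _))// mulrDr; apply: lerD.
  by rewrite (le_trans (norm1M _ _ _))// ler_pM ?norm1_ge0 ?Pd ?zS.
have W0 s : a <= s <= b -> 0 <= W s.
  by move=> sab; rewrite (le_trans _ (wW s sab))// norm1_ge0.
apply: (@le_trans _ _ (rint x (fun s => d * W s))).
  apply: (cint_norm1_le _ _ b) => //; last 2 first.
  - exact: rL1Z.
  - by move=> s sab; rewrite (le_trans (norm1M _ _ _))// ler_pM ?norm1_ge0 ?Pd ?wW.
  apply: cL1_eq (cL1M _ _ _ _ _ Hz.1 (AC_bmeas _ _ _ leab _ _ HP)) => s _.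
  by rewrite mulrC.
rewrite (rintZ _ _ b)//; apply: ler_wpM2l => //.
by apply: (rint_mono _ _ b).
Qed.

Lemma half_double (u : C) : (2^-1 : R)%:C * (u + u) = u.
Proof.
apply: complex_eq; rewrite ?ReM ?ImM ?ReD ?ImD /=; first by lra.
by lra.
Qed.

(* For [m = 3] the derivative of the first component contains [Q] itself, so
   that integrating by parts once leaves the term [P * q * z 0] with [P' = q];
   it is handled through the primitive [P ^ 2 / 2] of [P * q]. *)
Lemma coefficient_perturbation (Q0 : R -> C) (lam : C) : cL1 Q0 ->
  exists2 A : R, 0 <= A & forall (Q g : R -> C) (z : nat -> R -> C) (d S : R),
    cL1 Q -> qsol Q lam g z -> 0 <= d <= 1 ->
    (forall t, a <= t <= b -> norm1 (cint t (fun s => Q s - Q0 s)) <= d) ->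
    0 <= S -> (forall x, a <= x <= b -> vec_norm1 m (fun k => z k x) <= S) ->
    forall x, a <= x <= b ->
    norm1 (cint x (fun s => (Q s - Q0 s) * z 0%N s)) <= A * d * S /\
    norm1 (cint x (fun s => (Q s - Q0 s) * z 1%N s)) <= A * d * S.
Proof.
move=> Q0i; have nc := norm1_ge0 _ c.
set I0 := rint b (fun s => norm1 (Q0 s)).
have I00 : 0 <= I0.
  by apply: (rint_ge0 _ _ b) => // [|x _]; [exact: rL1_norm1|exact: norm1_ge0].
pose l := b - a; have l0 : 0 <= l by rewrite subr_ge0.
(* Read off from the worst case [m = 3]: [1 + l] comes from integrating by parts against bounded
   components, [norm1 c * (1 + l)] from the [P ^ 2 / 2] term, [norm1 c * I0] from the [Q0] part of
   the derivative of [z 1]. *)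
exists ((1 + norm1 c) * (1 + l) + norm1 c * I0).
  by apply: addr_ge0; apply: mulr_ge0 => //; apply: addr_ge0.
move=> Q g z d S Qi zs /andP[d0 d1] Pd S0 zS.
pose q s := Q s - Q0 s; have qi : cL1 q by exact: cL1B.
pose P t := cint t q.
have HP : AC_with_deriv a b P q by exact: AC_cint.
have Pa : P a = 0 by exact: cint_start.
have zkS k x : (k < m)%N -> a <= x <= b -> norm1 (z k x) <= S.
  by move=> km xab; rewrite (le_trans (norm1_le_vec_norm1 _ _ (fun k => z k x) _ km))// zS.
have cS : rL1 (fun=> S) by exact/rbmeas_L1/rbmeas_cst.
have rcS : rint b (fun=> S) = S * l by rewrite rint_cst.
have dS := mulr_ge0 d0 S0.
have w0 : AC_with_deriv a b (z 0%N) (z 1%N).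
  by apply: AC_deriv_eq (zs 0%N m_pos) _ => s _; rewrite /qrhs m3.
have B0 x : a <= x <= b -> norm1 (cint x (fun s => q s * z 0%N s)) <= d * (S + S * l).
  move=> xab; rewrite -rcS; apply: (by_parts_bound P _ _ (z 1%N)) => // s sab.
    exact/zkS/sab/m_pos.
  exact/zkS/sab/m_gt1.
have cl := mulr_ge0 nc l0; have cI := mulr_ge0 nc I00.
have dSl := mulr_ge0 dS l0; have dSc := mulr_ge0 dS nc.
have dScl := mulr_ge0 dS cl; have dScI := mulr_ge0 dS cI.
move=> x xab; have /andP[ax xb] := xab.
split; first by apply: le_trans (B0 x xab) _; nra.
(* For [m > 3] the derivative of [z 1] is [z 2], without potential, and the argument for [z 0]
   repeats; only [m = 3] is then left. *)
have [m4|m4] := ltnP 3 m.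
  have w1 : AC_with_deriv a b (z 1%N) (z 2%N).
    by apply: AC_deriv_eq (zs 1%N m_gt1) _ => s _; rewrite /qrhs m4.
  have H : norm1 (cint x (fun s => q s * z 1%N s)) <= d * (S + S * l).
    rewrite -rcS; apply: (by_parts_bound P _ _ (z 2%N)) => // s sab.
      exact/zkS/sab/m_gt1.
    exact: zkS.
  by apply: le_trans H _; nra.
have me : m = 3%N by apply/eqP; rewrite eqn_leq m4 m3.
pose w1 s := z 2%N s - c * Q s * z 0%N s.
have w1E : AC_with_deriv a b (z 1%N) w1.
  apply: AC_deriv_eq (zs 1%N m_gt1) _ => s _.
  by rewrite /qrhs [in (_ < _)%N]me ltnn [in _ == _]me eqxx.
pose P2 s := (2^-1 : R)%:C * (P s * P s).
have P2E : AC_with_deriv a b P2 (fun s => P s * q s).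
  apply: AC_deriv_eq (AC_Z _ _ _ _ _ _ (AC_mul _ _ _ leab _ _ _ _ HP HP)) _.
  by move=> s _; rewrite [q s * _]mulrC half_double.
(* Here [d <= 1] enters: [d ^ 2 / 2 <= d] keeps the bound linear in [d]. *)
have P2d s : a <= s <= b -> norm1 (P2 s) <= d.
  move=> sab; rewrite (le_trans (norm1M _ _ _))//.
  have -> : norm1 (2^-1 : R)%:C = 2^-1 by rewrite norm1E /= normr0 addr0 ger0_norm.
  have := norm1M _ (P s) (P s); have := Pd s sab; have := norm1_ge0 _ (P s).
  rewrite -/(P s); set pp := norm1 (P s * P s); set ps := norm1 (P s); nra.
have B2 : norm1 (cint x (fun s => P s * q s * z 0%N s)) <= d * (S + S * l).
  rewrite -rcS; apply: (by_parts_bound P2 _ _ (z 1%N)) => //.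
  - by rewrite /P2 Pa !mulr0.
  - by move=> s sab; exact/zkS/sab/m_pos.
  - by move=> s sab; exact/zkS/sab/m_gt1.
(* Writing [Q = Q0 + q] inside [w1], [r] collects the part of [P * w1] that involves only the fixed
   [Q0]; what remains is [- c * P * q * z 0]. *)
pose r s := P s * (z 2%N s - c * Q0 s * z 0%N s).
have zB := qsol_bmeas _ _ _ _ zs; have PB := AC_bmeas _ _ _ leab _ _ HP.
have u0i : cL1 (fun s => z 2%N s - c * Q0 s * z 0%N s).
  apply: cL1B; first exact/cbmeas_L1/zB.
  by apply: cL1M; [exact: cL1Z|exact/zB/m_pos].
have ri : cL1 r.
  by apply: cL1_eq (cL1M _ _ _ _ _ u0i PB) => s _; rewrite mulrC.
have Pqzi : cL1 (fun s => P s * q s * z 0%N s).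
  apply: cL1M; last exact/zB/m_pos.
  by apply: cL1_eq (cL1M _ _ _ _ _ qi PB) => s _; rewrite mulrC.
have Br : norm1 (cint x r) <= d * (S * l + norm1 c * I0 * S).
  have Wi : rL1 (fun s => d * (S + norm1 c * S * norm1 (Q0 s))).
    by apply/rL1Z/rL1D => //; apply: rL1Z; exact: rL1_norm1.
  apply: (@le_trans _ _ (rint x (fun s => d * (S + norm1 c * S * norm1 (Q0 s))))).
    apply: (cint_norm1_le _ _ b) => // s sab.
    rewrite (le_trans (norm1M _ _ _))// ler_pM ?norm1_ge0//; first exact: Pd.
    rewrite (le_trans (norm1B _ _ _))// lerD//; first exact: zkS.
    rewrite [leRHS]mulrAC (le_trans (norm1M _ _ _))// ler_pM ?norm1_ge0//; first exact: norm1M.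
    exact/zkS/sab/m_pos.
  have -> : d * (S * l + norm1 c * I0 * S) = rint b (fun s => d * (S + norm1 c * S * norm1 (Q0 s))).
    have Q0n := rL1_norm1 _ _ _ _ Q0i.
    rewrite (rintZ _ _ b)//; last by apply/rL1D => //; apply: rL1Z.
    rewrite (rintD _ _ b)//; last exact: rL1Z.
    by rewrite (rintZ _ _ b)// rcS -/I0; ring.
  apply: (rint_mono _ _ b) => // s sab.
  by rewrite mulr_ge0// addr_ge0// !mulr_ge0// norm1_ge0.
rewrite (by_parts P q (z 1%N) w1)//.
have -> : cint x (fun s => P s * w1 s) = cint x r - c * cint x (fun s => P s * q s * z 0%N s).
  rewrite -(cintZ _ _ b)// -(cintB _ _ b)//; last exact: cL1Z.
  by apply: cint_eq => s _; rewrite /r /w1 /q; ring.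
apply: le_trans (norm1B _ _ _) _.
apply: (@le_trans _ _ (d * S + (d * (S * l + norm1 c * I0 * S) + norm1 c * (d * (S + S * l))))).
  apply: lerD.
    by rewrite (le_trans (norm1M _ _ _))// ler_pM ?norm1_ge0 ?Pd// zkS// m_gt1.
  apply: le_trans (norm1B _ _ _) _; apply: lerD => //.
  by rewrite (le_trans (norm1M _ _ _))// ler_pM ?norm1_ge0.
nra.
Qed.

End QuasiSystem.

(** * The boundary value problem *)

Section BoundaryProblem.
Variables (R : realType) (a b : R).
Hypothesis leab : a <= b.
Variable m : nat.
Hypothesis m3 : (2 < m)%N.
Local Notation C := R[i].
Local Notation rint := (rint R a).
Local Notation norm1 := (norm1 R).
Local Notation cL1 := (cL1 a b).
Local Notation cint := (cint a).
Local Notation vec_norm1 := (vec_norm1 R m).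
Local Notation qsol := (qsol R a b m).
Local Notation c := ('i ^- m : C).

(** The difference of the solutions is propagated by [Q0] and forced by [(Q - Q0) z_j], so the
    Gronwall constant ignores [Q]. The forcing is at most a multiple of [d] times sup |z|, and
    [A * d <= 2^-1] lets that supremum be absorbed. *)
Lemma qsol_compare (Q0 : R -> C) (lam : C) : cL1 Q0 ->
  exists2 A : R, 0 <= A & forall (Q g : R -> C) (z y : nat -> R -> C) (d S0 : R),
    cL1 Q -> cL1 g -> qsol Q lam g z -> qsol Q0 lam g y ->
    (forall k, (k < m)%N -> z k a = y k a) -> 0 <= d <= 1 -> A * d <= 2^-1 ->
    (forall t, a <= t <= b -> norm1 (cint t (fun s => Q s - Q0 s)) <= d) ->
    0 <= S0 -> (forall x, a <= x <= b -> vec_norm1 (fun k => y k x) <= S0) ->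
    forall x, a <= x <= b -> vec_norm1 (fun k => z k x) <= 2 * S0 /\
      vec_norm1 (fun k => z k x - y k x) <= A * d * (2 * S0).
Proof.
move=> Q0i; have nc := norm1_ge0 _ c.
have [A1 A10 HA] := coefficient_perturbation _ _ _ leab _ m3 Q0 lam Q0i.
have [K K0 HK] := system_gronwall _ _ _ leab m _ (qlip_L1 _ _ _ m Q0 lam Q0i)
  (qlip_ge0 _ _ _ m Q0 lam).
exists (K * (norm1 c * A1)); first by rewrite !mulr_ge0.
move=> Q g z y d S0 Qi gi zs ys zya /andP[d0 d1] Ad Pd S00 yS.
have zB := qsol_bmeas _ _ _ leab _ _ _ _ _ zs.
have yB := qsol_bmeas _ _ _ leab _ _ _ _ _ ys.
(* Valid for any bound [S] of [z]: used first inside [absorb] with an unknown [S], then with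
   [S = 2 * S0]. *)
have step S : 0 <= S -> (forall x, a <= x <= b -> vec_norm1 (fun k => z k x) <= S) ->
    forall x, a <= x <= b -> vec_norm1 (fun k => z k x - y k x) <= K * (norm1 c * A1) * d * S.
  move=> SS zS x xab.
  have -> : K * (norm1 c * A1) * d * S = K * (norm1 c * (A1 * d * S)) by ring.
  have E0 : 0 <= norm1 c * (A1 * d * S) by rewrite !mulr_ge0.
  apply: (HK (fun k x => z k x - y k x)) => // [k km|k t km tab].
    by apply: cbmeasB; [exact: zB|exact: yB].
  have [zi ze] := zs k km; have [yi ye] := ys k km.
  have /andP[at_ tb] := tab.
  have zi0 := qrhs_L1 _ _ _ _ m3 Q0 lam g Q0i gi z zB k km.
  have -> : z k t - y k t =
     (cint t (fun x => qrhs R m Q lam g k x (fun j => z j x)) -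
      cint t (fun x => qrhs R m Q0 lam g k x (fun j => z j x))) +
     (cint t (fun x => qrhs R m Q0 lam g k x (fun j => z j x)) -
      cint t (fun x => qrhs R m Q0 lam g k x (fun j => y j x))).
    by rewrite (ze t tab) (ye t tab) (zya k km) opprD addrACA subrr add0r addrA subrK.
  apply: le_trans (norm1D _ _ _) _; apply: lerD; last first.
    exact: (cint_qrhs_dist _ _ b _ m3 Q0 lam g z y).
  rewrite -(cintB _ _ b)//.
  have [H0 H1] := HA Q g z d S Qi zs (introT andP (conj d0 d1)) Pd SS zS t tab.
  have qzi j : (j < m)%N -> cL1 (fun s => (Q s - Q0 s) * z j s).
    by move=> jm; apply: cL1M; [exact: cL1B|exact: zB].
  have [k2|k2] := ltnP k.+2 m.
    rewrite (cint_eq _ _ _ _ (fun=> 0)); last first.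
      by move=> s _; rewrite /qrhs k2 subrr.
    have -> : cint t (fun=> 0) = 0.
      by apply: complex_eq; rewrite ?Re_cint ?Im_cint rint_cst ?mul0r.
    by rewrite norm1_0.
  have [k2e|k2n] := eqVneq k.+2 m.
    rewrite (cint_eq _ _ _ _ (fun s => (- c) * ((Q s - Q0 s) * z 0%N s))); last first.
      by move=> s _; rewrite /qrhs ltnNge k2 /= k2e eqxx; ring.
    rewrite (cintZ _ _ b)//; last exact/qzi/m_pos.
    by apply: le_trans (norm1M _ _ _) _; rewrite norm1N ler_wpM2l.
  rewrite (cint_eq _ _ _ _ (fun s => c * ((Q s - Q0 s) * z 1%N s))); last first.
    by move=> s _; rewrite /qrhs ltnNge k2 /= (negbTE k2n); ring.
  rewrite (cintZ _ _ b)//; last exact/qzi/m_gt1.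
  by apply: le_trans (norm1M _ _ _) _; rewrite ler_wpM2l.
have zS : forall x, a <= x <= b -> vec_norm1 (fun k => z k x) <= 2 * S0.
  apply: (absorb _ _ _ leab (fun x => vec_norm1 (fun k => z k x))) => //.
    exact: rbmeas_vec_norm1.
  move=> S SS zS x xab.
  apply: (@le_trans _ _ (vec_norm1 (fun k => y k x) + vec_norm1 (fun k => z k x - y k x))).
    apply: vec_norm1_le_add => k km; apply: le_trans (norm1D _ _ _).
    by rewrite addrC subrK.
  apply: lerD; first exact: yS.
  apply: le_trans (step S SS zS x xab) _.
  by rewrite mulrC; apply: ler_wpM2l.
move=> x xab; split; first exact: zS.
by apply: step => //; rewrite mulr_ge0.
Qed.

Definition col_norm1 (v : 'cV[C]_m) : R := \sum_i norm1 (v i 0).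

Definition mx_norm1 (A : 'M[C]_m) : R := \sum_i \sum_j norm1 (A i j).

Lemma col_norm1_ge0 v : 0 <= col_norm1 v.
Proof. by apply: sumr_ge0 => i _; exact: norm1_ge0. Qed.

Lemma mx_norm1_ge0 A : 0 <= mx_norm1 A.
Proof. by apply: sumr_ge0 => i _; apply: sumr_ge0 => j _; exact: norm1_ge0. Qed.

Lemma col_norm10 : col_norm1 0 = 0.
Proof. by apply: big1 => i _; rewrite mxE norm1_0. Qed.

Lemma col_norm1D u v : col_norm1 (u + v) <= col_norm1 u + col_norm1 v.
Proof.
by rewrite /col_norm1 -big_split/=; apply: ler_sum => i _; rewrite mxE norm1D.
Qed.

Lemma col_norm1N v : col_norm1 (- v) = col_norm1 v.
Proof. by apply: eq_bigr => i _; rewrite mxE norm1N. Qed.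

Lemma col_norm1_mul A v : col_norm1 (A *m v) <= mx_norm1 A * col_norm1 v.
Proof.
rewrite /mx_norm1 mulr_suml; apply: ler_sum => i _; rewrite mxE mulr_suml.
apply: le_trans (norm1_sum _ _ _) _; apply: ler_sum => j _.
apply: le_trans (norm1M _ _ _) _; rewrite ler_wpM2l ?norm1_ge0//.
rewrite /col_norm1 (bigD1 j)//= lerDl.
by apply: sumr_ge0 => k _; exact: norm1_ge0.
Qed.

Lemma col_norm1_col (p : nat -> C) : col_norm1 (\col_(k < m) p k) = vec_norm1 p.
Proof. by apply: eq_bigr => k _; rewrite mxE. Qed.

Definition boundary_vec (al be : 'M[C]_m) (z : nat -> R -> C) : 'cV[C]_m :=
  al *m (\col_(k < m) z k a) + be *m (\col_(k < m) z k b).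

Lemma boundary_vecD al be z z' : boundary_vec al be (fun k x => z k x + z' k x) =
  boundary_vec al be z + boundary_vec al be z'.
Proof.
rewrite /boundary_vec.
have H t : \col_(k < m) (z k t + z' k t) = \col_(k < m) z k t + \col_(k < m) z' k t.
  by apply/colP => k; rewrite !mxE.
by rewrite !H !mulmxDr addrACA.
Qed.

Lemma boundary_vecB al be z z' : boundary_vec al be (fun k x => z k x - z' k x) =
  boundary_vec al be z - boundary_vec al be z'.
Proof.
rewrite /boundary_vec.
have H t : \col_(k < m) (z k t - z' k t) = \col_(k < m) z k t - \col_(k < m) z' k t.
  by apply/colP => k; rewrite !mxE.
by rewrite !H !mulmxBr opprD addrACA.
Qed.

(** [lam] is not an eigenvalue. Only initial data are mentioned because they determine the
    solution. *)
Definition homogeneous_trivial Q lam al be := forall z,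
  qsol Q lam (fun=> 0) z -> boundary_vec al be z = 0 -> forall k, (k < m)%N -> z k a = 0.

Lemma rint_zero : rint b (fun=> norm1 0) = 0.
Proof. by rewrite rint_cst// norm1_0 mul0r. Qed.

(** Fredholm alternative in dimension [m]: superposition reduces the problem to the characteristic
    matrix [M], for which injectivity is invertibility. The bound keeps the boundary residual, so
    that it also applies to functions satisfying the boundary condition only approximately. *)
Lemma bvp (Q : R -> C) lam al be : cL1 Q -> homogeneous_trivial Q lam al be ->
  (forall g, cL1 g -> exists z, qsol Q lam g z /\ boundary_vec al be z = 0) /\
  exists2 K : R, 0 <= K & forall g z, cL1 g -> qsol Q lam g z ->
    forall x, a <= x <= b ->
      vec_norm1 (fun k => z k x) <= K * (col_norm1 (boundary_vec al be z) + rint b (fun s => norm1 (g s))).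
Proof.
move=> Qi triv; have zL1 : cL1 (fun=> 0) by exact/cbmeas_L1/cbmeas_cst.
have [K K0 HK] := qsol_bound _ _ _ leab _ m3 Q lam Qi.
have ivp g := qsol_exists _ _ _ leab _ m3 Q lam g Qi.
(* Columns of the fundamental matrix, normalised to the identity at [a]. *)
have /choice[Y HY] (j : nat) := ivp _ zL1 (fun k => (k == j)%:R).
pose Ya := \matrix_(k < m, j < m) Y j k a; pose Yb := \matrix_(k < m, j < m) Y j k b.
pose M := al *m Ya + be *m Yb.
pose comb (v : nat -> C) k x := \sum_(j < m) v j * Y j k x.
have combs v : qsol Q lam (fun=> 0) (comb v).
  by apply: qsol_sum => j _; exact: (HY j).2.
have comba v k : (k < m)%N -> comb v k a = v k.
  move=> km; rewrite /comb (bigD1 (Ordinal km))//= (HY k).1// eqxx mulr1.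
  rewrite big1 ?addr0// => j jk; rewrite (HY j).1//.
  by rewrite (_ : (k == j) = false) ?mulr0//; apply/eqP => kj; move/eqP: jk; apply; apply: val_inj.
have bcomb v : boundary_vec al be (comb v) = M *m \col_(k < m) v k.
  have H t : \col_(k < m) comb v k t = (\matrix_(k < m, j < m) Y j k t) *m \col_(k < m) v k.
    apply/colP => k; rewrite !mxE; apply: eq_bigr => j _.
    by rewrite !mxE mulrC.
  by rewrite /boundary_vec !H !mulmxA -mulmxDl.
(* A kernel vector of a singular [M] would be the initial data of a nonzero homogeneous solution.
   Since [det0P] yields a row vector, the determinant is transposed first. *)
have Munit : M \in unitmx.
  rewrite unitmxE unitfE -det_tr; apply/negP => /eqP/eqP/det0P[v v0 vM].
  (* Initial data are indexed by [nat]; the vector is extended by 0 beyond [m]. *)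
  pose vv k := if insub k is Some i then v 0 i else 0.
  have vvE (i : 'I_m) : vv i = v 0 i by rewrite /vv valK.
  have colv : \col_(k < m) vv k = v^T by apply/colP => i; rewrite !mxE vvE.
  have := triv (comb vv) (combs vv).
  rewrite bcomb colv -[M]trmxK -trmx_mul vM trmx0 => /(_ erefl) H.
  case/negP: v0; apply/eqP/rowP => i; rewrite mxE -vvE -(comba vv)//.
  exact: H.
(* Zero initial data leave only the [be] term in the boundary vector. *)
have part g : cL1 g -> exists p, [/\ qsol Q lam g p, forall k, (k < m)%N -> p k a = 0 &
    col_norm1 (boundary_vec al be p) <= mx_norm1 be * (K * rint b (fun s => norm1 (g s)))].
  move=> gi; have [p [pa ps]] := ivp g gi (fun=> 0); exists p; split => //.
  have bab : a <= b <= b by rewrite leab lexx.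
  have aE : \col_(k < m) p k a = 0 by apply/colP => k; rewrite !mxE pa.
  rewrite /boundary_vec aE mulmx0 add0r; apply: le_trans (col_norm1_mul _ _) _.
  rewrite (col_norm1_col (fun k => p k b)) ler_wpM2l ?mx_norm1_ge0//.
  have := HK g p gi ps b bab.
  by rewrite -(col_norm1_col (fun k => p k a)) aE col_norm10 add0r.
split=> [g gi|].
  have [p [ps pa _]] := part g gi.
  pose v := - (invmx M *m boundary_vec al be p).
  pose vv k := if insub k is Some i then v i 0 else 0.
  have colv : \col_(k < m) vv k = v by apply/colP => i; rewrite mxE /vv valK.
  exists (fun k x => p k x + comb vv k x); split; last first.
    by rewrite boundary_vecD bcomb colv mulmxN mulKVmx// subrr.
  have := qsol_lin _ _ _ _ _ _ _ _ 1 _ _ ps (combs vv).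
  have -> : (fun k x => p k x + 1 * comb vv k x) = (fun k x => p k x + comb vv k x).
    by apply/funext => k; apply/funext => x; rewrite mul1r.
  by apply: qsol_eqg => x; rewrite mulr0 addr0.
pose B := mx_norm1 (invmx M); have B0 : 0 <= B by exact: mx_norm1_ge0.
have be0 := mx_norm1_ge0 be.
exists (K * (B * (1 + mx_norm1 be * K) + 1)).
  by rewrite !(mulr_ge0, addr_ge0).
move=> g z gi zs x xab; have [p [ps pa pb]] := part g gi.
set G := rint b _.
have G0 : 0 <= G.
  by apply: (rint_ge0 _ _ b) => // [|s _]; [exact: rL1_norm1|exact: norm1_ge0].
pose w k x := z k x - p k x; have ws : qsol Q lam (fun=> 0) w by exact: qsol_sub zs ps.
(* [e] solves the homogeneous system with zero initial data, so [qsol_bound] makes it vanish and [w]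
   is the combination of the columns. *)
pose e k x := w k x - comb (fun k => z k a) k x.
have es : qsol Q lam (fun=> 0) e by exact: qsol_sub ws (combs _).
have ebnd y : a <= y <= b -> vec_norm1 (fun k => e k y) <= 0.
  move=> yab; apply: le_trans (HK _ _ zL1 es y yab) _.
  rewrite rint_zero addr0 (_ : vec_norm1 _ = 0) ?mulr0//.
  by apply: big1 => k _; rewrite /e /w pa// comba// subr0 subrr norm1_0.
have eE k y : (k < m)%N -> a <= y <= b -> w k y = comb (fun k => z k a) k y.
  move=> km yab; apply/eqP; rewrite -subr_eq0; apply/eqP/(norm1_eq0 R).
  apply: le_trans (ebnd y yab); exact: (norm1_le_vec_norm1 _ _ (fun k => e k y)).
have bw : boundary_vec al be w = M *m \col_(k < m) z k a.
  have H y : a <= y <= b ->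
      \col_(k < m) w k y = \col_(k < m) comb (fun k => z k a) k y.
    by move=> yab; apply/colP => k; rewrite !mxE eE.
  by rewrite -(bcomb (fun k => z k a)) /boundary_vec !H ?lexx ?leab.
(* The initial data of [z] are [invmx M] applied to the boundary vector of [z - p]. *)
have va : vec_norm1 (fun k => z k a) <= B * (col_norm1 (boundary_vec al be z) + mx_norm1 be * (K * G)).
  rewrite -(col_norm1_col (fun k => z k a)) -[X in col_norm1 X](mulKmx Munit) -bw.
  apply: le_trans (col_norm1_mul _ _) _; rewrite ler_wpM2l// boundary_vecB.
  by apply: le_trans (col_norm1D _ _) _; rewrite col_norm1N lerD2l.
apply: le_trans (HK g z gi zs x xab) _; rewrite -mulrA; apply: ler_wpM2l => //.
set r := col_norm1 (boundary_vec al be z); have r0 : 0 <= r by exact: col_norm1_ge0.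
rewrite -/G -/r in va *.
have h1 : 0 <= B * G by rewrite mulr_ge0.
have h2 : 0 <= B * (mx_norm1 be * K) * r by rewrite !mulr_ge0.
apply: le_trans (lerD va (lexx G)) _; nra.
Qed.

End BoundaryProblem.

(** * Perturbation of the boundary value problem *)

Section Perturbation.
Variables (R : realType) (a b : R).
Hypothesis leab : a <= b.
Variable m : nat.
Hypothesis m3 : (2 < m)%N.
Local Notation C := R[i].
Local Notation rint := (rint R a).
Local Notation norm1 := (norm1 R).
Local Notation cL1 := (cL1 a b).
Local Notation cint := (cint a).
Local Notation vec_norm1 := (vec_norm1 R m).
Local Notation qsol := (qsol R a b m).
Local Notation boundary_vec := (boundary_vec R a b m).
Local Notation mx_norm1 := (mx_norm1 R m).
Local Notation col_norm1 := (col_norm1 R m).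

(* [z] is compared with the solution [y] of the unperturbed system sharing its
   initial data; the boundary residual of [y] is small relative to [y]. *)
Lemma bvp_perturbation (Q0 : R -> C) lam al0 be0 : cL1 Q0 ->
  homogeneous_trivial R a b m Q0 lam al0 be0 ->
  exists d0 : R, exists K : R, [/\ 0 < d0, 0 <= K &
  forall (Q : R -> C) al be d, cL1 Q -> 0 <= d <= d0 ->
    (forall t, a <= t <= b -> norm1 (cint t (fun s => Q s - Q0 s)) <= d) ->
    mx_norm1 (al0 - al) <= d -> mx_norm1 (be0 - be) <= d ->
    forall g z, cL1 g -> qsol Q lam g z -> boundary_vec al be z = 0 ->
    (forall x, a <= x <= b ->
       vec_norm1 (fun k => z k x) <= K * rint b (fun s => norm1 (g s))) /\
    (forall z0, qsol Q0 lam g z0 -> boundary_vec al0 be0 z0 = 0 ->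
       forall x, a <= x <= b ->
       vec_norm1 (fun k => z k x - z0 k x) <= K * d * rint b (fun s => norm1 (g s)))].
Proof.
move=> Q0i triv; have zL1 : cL1 (fun=> 0) by exact/cbmeas_L1/cbmeas_cst.
have [A A0 HA] := qsol_compare _ _ _ leab _ m3 Q0 lam Q0i.
have [_ [Kb Kb0 HK]] := bvp _ _ _ leab _ m3 Q0 lam al0 be0 Q0i triv.
have nb0 : 0 <= mx_norm1 be0 by exact: mx_norm1_ge0.
(* Residual of [y] in units of [d * S]: 1 for [al0 - al] on [y(a)], 2 for [be0 - be] on [z(b)] (as
   |z| <= 2 S), and [2 * A * mx_norm1 be0] for [be0] on [z(b) - y(b)]. *)
pose B := 3 + 2 * A * mx_norm1 be0.
have B0 : 0 <= B by rewrite addr_ge0 ?mulr_ge0.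
have KB0 : 0 <= Kb * B by rewrite mulr_ge0.
have D0 : 0 < 1 + 2 * A + 2 * (Kb * B) by lra.
(* The threshold gives [d <= 1], [A * d <= 1/2] and [Kb * B * d <= 1/2] together. In [K], [4 * Kb]
   bounds [z], [4 * (A * Kb)] bounds [z - y] and [2 * (Kb * B * Kb)] bounds [y - z0], the last two
   up to the factor [d]. *)
exists (1 + 2 * A + 2 * (Kb * B))^-1, (4 * Kb + 4 * (A * Kb) + 2 * (Kb * B * Kb)).
split; first by rewrite invr_gt0.
  by rewrite !addr_ge0 ?mulr_ge0.
move=> Q al be d Qi /andP[d0 dd] Pd ald bed g z gi zs bz.
have {}dd : d * (1 + 2 * A + 2 * (Kb * B)) <= 1.
  by rewrite -ler_pdivlMr// mul1r.
have dA := mulr_ge0 d0 A0; have dKB := mulr_ge0 d0 KB0.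
have d1 : d <= 1 by nra.
have Ad : A * d <= 2^-1 by nra.
have KBd : Kb * B * d <= 2^-1 by nra.
set G := rint b _; have G0 : 0 <= G.
  by apply: (rint_ge0 _ _ b) => // [|s _]; [exact: rL1_norm1|exact: norm1_ge0].
have [y [ya ys]] := qsol_exists _ _ _ leab _ m3 Q0 lam g Q0i gi (fun k => z k a).
have bab : a <= b <= b by rewrite leab lexx.
have aab : a <= a <= b by rewrite leab lexx.
have cmp S : 0 <= S -> (forall x, a <= x <= b -> vec_norm1 (fun k => y k x) <= S) ->
    forall x, a <= x <= b -> vec_norm1 (fun k => z k x) <= 2 * S /\
      vec_norm1 (fun k => z k x - y k x) <= A * d * (2 * S).
  move=> S0 yS; apply: (HA Q g) => //; last by rewrite d0.
  by move=> k km; rewrite ya.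
have res S : 0 <= S -> (forall x, a <= x <= b -> vec_norm1 (fun k => y k x) <= S) ->
    col_norm1 (boundary_vec al0 be0 y) <= d * B * S.
  move=> S0 yS; have [z2 zy] := cmp S S0 yS b bab.
  (* The zero vector [boundary_vec al be z] is subtracted and [z(a) = y(a)] is used, so that every
     term carries a small difference. *)
  have -> : boundary_vec al0 be0 y = (al0 - al) *m (\col_(k < m) y k a) +
      (be0 - be) *m (\col_(k < m) z k b) - be0 *m (\col_(k < m) (z k b - y k b)).
    rewrite -[LHS]subr0 -bz.
    have -> : \col_(k < m) (z k b - y k b) = \col_(k < m) z k b - \col_(k < m) y k b.
      by apply/colP => k; rewrite !mxE.
    have aE : \col_(k < m) z k a = \col_(k < m) y k a.
      by apply/colP => k; rewrite !mxE ya.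
    rewrite /boundary_vec aE mulmxBr !mulmxBl.
    move: (al0 *m _) (al *m _) (be0 *m \col_k z k b) (be0 *m _) (be *m _) => p q r s t.
    by apply/colP => k; rewrite !mxE; ring.
  apply: le_trans (col_norm1D _ _ _ _) _; rewrite col_norm1N.
  have h1 : col_norm1 ((al0 - al) *m (\col_(k < m) y k a)) <= d * S.
    apply: le_trans (col_norm1_mul _ _ _ _) _; rewrite (col_norm1_col _ _ (fun k => y k a)).
    by rewrite ler_pM ?mx_norm1_ge0 ?vec_norm1_ge0// yS.
  have h2 : col_norm1 ((be0 - be) *m (\col_(k < m) z k b)) <= d * (2 * S).
    apply: le_trans (col_norm1_mul _ _ _ _) _; rewrite (col_norm1_col _ _ (fun k => z k b)).
    by rewrite ler_pM ?mx_norm1_ge0 ?vec_norm1_ge0.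
  have h3 : col_norm1 (be0 *m (\col_(k < m) (z k b - y k b))) <= mx_norm1 be0 * (A * d * (2 * S)).
    apply: le_trans (col_norm1_mul _ _ _ _) _; rewrite (col_norm1_col _ _ (fun k => z k b - y k b)).
    by rewrite ler_wpM2l.
  have h4 := col_norm1D _ _ ((al0 - al) *m (\col_(k < m) y k a)) ((be0 - be) *m (\col_(k < m) z k b)).
  have -> : d * B * S = d * S + d * (2 * S) + mx_norm1 be0 * (A * d * (2 * S)).
    by rewrite /B; ring.
  by apply: lerD => //; apply: le_trans h4 _; exact: lerD.
have KG : 0 <= Kb * G by rewrite mulr_ge0.
(* A second absorption: the a priori bound for [y] contains its own residual, at most [d * B * S],
   and [Kb * B * d <= 1/2]. *)
have yb : forall x, a <= x <= b -> vec_norm1 (fun k => y k x) <= 2 * (Kb * G).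
  apply: (absorb _ _ _ leab (fun x => vec_norm1 (fun k => y k x))) => //.
    by apply: rbmeas_vec_norm1 => k km; exact: (qsol_bmeas _ _ _ leab _ _ _ _ _ ys).
  move=> S S0 yS x xab; apply: le_trans (HK g y gi ys x xab) _; rewrite -/G.
  have h1 := ler_wpM2l Kb0 (res S S0 yS).
  have h2 := ler_wpM2r S0 KBd.
  by rewrite mulrDr addrC lerD2l; apply: le_trans h1 _; lra.
have KG2 : 0 <= 2 * (Kb * G) by rewrite mulr_ge0.
have AK : 0 <= A * Kb by rewrite mulr_ge0.
have KBK : 0 <= Kb * B * Kb by rewrite mulr_ge0.
split=> [x xab|z0 z0s bz0 x xab].
  have [h _] := cmp _ KG2 yb x xab; apply: le_trans h _.
  have := mulr_ge0 AK G0; have := mulr_ge0 KBK G0; lra.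
have [_ h] := cmp _ KG2 yb x xab.
(* [y - z0] solves the homogeneous unperturbed system, and its boundary vector is just the residual
   of [y]. *)
have sub := qsol_sub _ _ _ _ _ _ _ _ _ ys z0s.
have h2 := HK _ _ zL1 sub x xab.
rewrite (boundary_vecB R a b m al0 be0 y z0) bz0 subr0 (rint_zero _ _ _ leab) addr0 in h2.
have h3 := ler_wpM2l Kb0 (res _ KG2 yb).
apply: (@le_trans _ _ (vec_norm1 (fun k => z k x - y k x) + vec_norm1 (fun k => y k x - z0 k x))).
  apply: vec_norm1_le_add => k km; apply: le_trans (norm1D _ _ _).
  by rewrite addrA subrK.
apply: le_trans (lerD h (le_trans h2 h3)) _.
have := mulr_ge0 d0 KG; nra.
Qed.

End Perturbation.

(** * Operator graphs and L_2 norms *)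

Section GraphAndNorms.
Variables (R : realType) (a b : R).
Hypothesis ltab : a < b.
Let leab : a <= b := ltW ltab.
Variable m : nat.
Hypothesis m3 : (2 < m)%N.
Local Notation C := R[i].
Local Notation rL1 := (rL1 R a b).
Local Notation rAC := (rAC R a b).
Local Notation cbmeas := (cbmeas R a b).
Local Notation rint := (rint R a).
Local Notation norm1 := (norm1 R).
Local Notation cL1 := (cL1 a b).
Local Notation cL2 := (cL2 a b).
Local Notation cint := (cint a).
Local Notation ae_eq := (@Defs.ae_eq R).
Local Notation vec_norm1 := (vec_norm1 R m).
Local Notation qsol := (qsol R a b m).
Local Notation boundary_vec := (boundary_vec R a b m).

Lemma rL1_dom (f g : R -> R) : measurable_fun `[a, b] f -> rL1 g ->
  (forall x, a <= x <= b -> `|f x| <= g x) -> rL1 f.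
Proof.
move=> mf gi fg; apply: le_integrable gi => //; first exact/measurable_EFinP.
move=> x; rewrite mem_itv_set => xab /=; rewrite lee_fin.
by rewrite (le_trans (fg x xab))// ler_norm.
Qed.

Lemma csqnorm_ge0 (u : C) : 0 <= csqnorm u.
Proof. by rewrite addr_ge0 ?sqr_ge0. Qed.

Lemma measurable_csqnorm (f : R -> C) :
  measurable_fun `[a, b] (fun x => complex.Re (f x)) ->
  measurable_fun `[a, b] (fun x => complex.Im (f x)) ->
  measurable_fun `[a, b] (fun x => csqnorm (f x)).
Proof.
move=> mr mi; rewrite /csqnorm.
by apply: measurable_funD; apply: measurable_funX.
Qed.

Lemma cbmeas_L2 f : cbmeas f -> cL2 f.
Proof.
move=> fB; have [[mr _] [mi _]] := fB.
have [mn [B HB]] := rbmeas_norm1 _ _ _ _ fB.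
split=> //; split=> //.
apply: (rL1_dom _ (fun=> B ^+ 2)); first exact: measurable_csqnorm.
  exact/rbmeas_L1/rbmeas_cst.
move=> x xab; rewrite ger0_norm ?csqnorm_ge0//.
apply: le_trans (csqnorm1_le_norm _ _) _.
have := HB x xab; rewrite ger0_norm ?norm1_ge0// => h.
by rewrite ler_pXn2r// nnegrE ?norm1_ge0// (le_trans (norm1_ge0 _ _) h).
Qed.

Lemma cL2D f g : cL2 f -> cL2 g -> cL2 (fun x => f x + g x).
Proof.
move=> [fr [fi fs]] [gr [gi gs]].
have mr : measurable_fun `[a, b] (fun x => complex.Re (f x + g x)).
  have -> : (fun x => complex.Re (f x + g x)) =
            (fun x => complex.Re (f x) + complex.Re (g x)).
    by apply/funext => x; rewrite ReD.
  exact: measurable_funD.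
have mi : measurable_fun `[a, b] (fun x => complex.Im (f x + g x)).
  have -> : (fun x => complex.Im (f x + g x)) =
            (fun x => complex.Im (f x) + complex.Im (g x)).
    by apply/funext => x; rewrite ImD.
  exact: measurable_funD.
split=> //; split=> //.
apply: (rL1_dom _ (fun x => 2 * (csqnorm (f x) + csqnorm (g x)))).
- exact: measurable_csqnorm.
- by apply: rL1Z; apply: rL1D.
- move=> x xab; rewrite ger0_norm ?csqnorm_ge0// /csqnorm ReD ImD.
  have := sqr_ge0 (complex.Re (f x) - complex.Re (g x)).
  have := sqr_ge0 (complex.Im (f x) - complex.Im (g x)).
  rewrite !expr2; lra.
Qed.

Lemma cL2_L1 f : cL2 f -> cL1 f.
Proof.
move=> [fr [fi fs]].
have one : rL1 (fun x => 1 + csqnorm (f x)) by apply: rL1D; [exact/rbmeas_L1/rbmeas_cst|].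
by split; apply: (rL1_dom _ (fun x => 1 + csqnorm (f x))) => // x xab;
  rewrite /csqnorm -(real_normK (num_real (complex.Re (f x))))
    -(real_normK (num_real (complex.Im (f x))));
  have := sqr_ge0 (`|complex.Re (f x)| - 1); have := sqr_ge0 (`|complex.Im (f x)| - 1);
  have := sqr_ge0 `|complex.Re (f x)|; have := sqr_ge0 `|complex.Im (f x)|;
  rewrite !expr2; lra.
Qed.

Lemma cL2norm_ge0 f : 0 <= cL2norm a b f.
Proof. exact: sqrtr_ge0. Qed.

(* AM-GM with a free parameter [t], which tends to the L^2 norm. *)
Lemma L1_le_L2 f : cL2 f ->
  rint b (fun x => norm1 (f x)) <= (1 + (b - a)) * cL2norm a b f.
Proof.
move=> fL2; have [fr [fi fs]] := fL2.
have ni := rL1_norm1 _ _ _ _ (cL2_L1 _ fL2).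
set N := cL2norm a b f; have N0 : 0 <= N by exact: cL2norm_ge0.
have NE : rint b (fun x => csqnorm (f x)) = N ^+ 2.
  rewrite /N /cL2norm sqr_sqrtr//.
  by apply: (rint_ge0 _ _ b) => // x _; exact: csqnorm_ge0.
have l0 : 0 <= b - a by rewrite subr_ge0.
apply: (le_geometric _ _ _ (b - a)) => n.
(* The positive shift [e] keeps [t = N + e] invertible when the L_2 norm is 0. *)
pose e : R := (2 ^+ n)^-1; have e0 : 0 < e by rewrite invr_gt0 exprn_gt0.
have [t t0 tE] : exists2 t : R, 0 < t & t = N + e by exists (N + e); rewrite // ltr_wpDl.
have cst i : rL1 (fun=> i : R) by exact/rbmeas_L1/rbmeas_cst.
apply: (@le_trans _ _ (rint b (fun x => t / 2 + t^-1 * csqnorm (f x)))).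
  apply: (rint_le _ _ b) => //; first by apply: rL1D => //; apply: rL1Z.
  move=> x _; have h := norm1_csqnorm _ (f x).
  have h2 : 0 <= t^-1 * (norm1 (f x) - t) ^+ 2 by apply: mulr_ge0; rewrite ?sqr_ge0// invr_ge0 ltW.
  have h3 : t^-1 * norm1 (f x) ^+ 2 <= t^-1 * (2 * csqnorm (f x)).
    by apply: ler_wpM2l => //; rewrite invr_ge0 ltW.
  have E : t^-1 * (norm1 (f x) - t) ^+ 2 = t^-1 * norm1 (f x) ^+ 2 - 2 * norm1 (f x) + t.
    by field; rewrite gt_eqF.
  by rewrite E in h2; lra.
rewrite (rintD _ _ b)//; last exact: rL1Z.
rewrite (rintZ _ _ b _ t^-1)// NE rint_cst//.
have h : t^-1 * N ^+ 2 <= N.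
  by rewrite mulrC ler_pdivrMr// expr2 ler_wpM2l// tE lerDl ltW.
have : (b - a) * e >= 0 by rewrite mulr_ge0// ltW.
have : (b - a) * N >= 0 by rewrite mulr_ge0.
rewrite -/e; move: h; set X := t^-1 * _; clearbody e X; rewrite tE; lra.
Qed.

(** [1 + (b - a)] replaces the sharp [sqrt (b - a)], matching the constant of the other
    inclusion. *)
Lemma L2norm_le_sup f (B : R) : cbmeas f -> 0 <= B ->
  (forall x, a <= x <= b -> norm1 (f x) <= B) ->
  cL2norm a b f <= (1 + (b - a)) * B.
Proof.
move=> fB B0 fBd; have [_ [_ fs]] := cbmeas_L2 _ fB.
have l0 : 0 <= b - a by rewrite subr_ge0.
have l1 : 0 <= (1 + (b - a)) * B by rewrite mulr_ge0// addr_ge0.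
rewrite -(ger0_norm l1) -sqrtr_sqr /cL2norm ler_wsqrtr//.
apply: (@le_trans _ _ (rint b (fun=> B ^+ 2))).
  apply: (rint_le _ _ b) => //; first exact/rbmeas_L1/rbmeas_cst.
  move=> x xab; apply: le_trans (csqnorm1_le_norm _ _) _.
  by rewrite ler_pXn2r// ?nnegrE ?norm1_ge0// fBd.
rewrite rint_cst// exprMn mulrC ler_wpM2r ?sqr_ge0//.
have := sqr_ge0 (b - a); rewrite !expr2; lra.
Qed.

(** [F] has mean 0 over every subinterval, while uniform continuity keeps that mean within e of
    [F x] on a short interval containing [x]. *)
Lemma rAC_zero (F f : R -> R) : rAC F f ->
  (forall x, a <= x <= b -> rint x F = 0) -> forall x, a <= x <= b -> F x = 0.
Proof.
move=> FA F0 x xab; have /andP[ax xb] := xab.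
have Fi := rbmeas_L1 _ _ _ _ (rAC_bmeas _ _ _ leab _ _ FA).
apply/eqP; rewrite -normr_le0.
apply/ler_addgt0Pl => e e0; rewrite addr0.
have [d d0 Hd] := rAC_unif _ _ _ _ _ FA e e0.
(* The interval lies to the right of [x], or to the left when [x = b]; its positive length uses
   [a < b]. *)
have [s [t [as_ st tb tsd /andP[sx xt]]]] : exists s t,
    [/\ a <= s, s < t, t <= b, t - s < d & s <= x <= t].
  have [xb'|bx] := ltP x b.
    exists x, (Num.min b (x + d / 2)); split => //.
    - by rewrite lt_min xb' ltrDl divr_gt0.
    - by rewrite ge_min lexx.
    - rewrite ltrBlDr gt_min; apply/orP; right; lra.
    - by rewrite lexx le_min xb lerDl divr_ge0// ltW.
  have xE : x = b by apply/eqP; rewrite eq_le xb.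
  exists (Num.max a (b - d / 2)), b; rewrite xE; split => //.
  - by rewrite le_max lexx.
  - by rewrite gt_max ltab/= ltrBlDr ltrDl divr_gt0.
  - rewrite ltrBlDr -ltrBlDl lt_max; apply/orP; right; lra.
  - rewrite lexx andbT ge_max leab/= lerBlDr lerDl divr_ge0// ltW//.
have ts0 : 0 < t - s by rewrite subr_gt0.
have at_ : a <= t by rewrite (le_trans as_)// ltW.
have sb : s <= b by rewrite (le_trans (ltW st)).
have cst i : rL1 (fun=> i : R) by exact/rbmeas_L1/rbmeas_cst.
have H : `|rint t (fun y => F x - F y) - rint s (fun y => F x - F y)| <=
    rint t (fun=> e) - rint s (fun=> e).
  apply: (rint_incr_norm _ _ b) => //; [exact: ltW|exact: rL1B|].
  move=> y /andP[sy yt].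
  have [xy|/ltW yx] := leP x y.
    rewrite distrC ltW// Hd//; first exact: le_trans yt tb.
    by apply: le_lt_trans tsd; rewrite lerD// lerN2.
  rewrite ltW// Hd//; first exact: le_trans sy.
  by apply: le_lt_trans tsd; rewrite lerD// lerN2.
rewrite !(rintB _ _ b)// !rint_cst// !F0 ?as_ ?at_// !subr0 in H.
move: H; rewrite -!mulrBr (_ : t - a - (s - a) = t - s); last by ring.
by rewrite normrM (gtr0_norm ts0) ler_pM2r.
Qed.

Lemma AC_zero z w : AC_with_deriv a b z w ->
  (forall x, a <= x <= b -> cint x z = 0) -> forall x, a <= x <= b -> z x = 0.
Proof.
move=> /ACP[zr zi] z0 x xab; apply: complex_eq => /=.
  by apply: (rAC_zero _ _ zr) => // y yab; rewrite -Re_cint z0.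
by apply: (rAC_zero _ _ zi) => // y yab; rewrite -Im_cint z0.
Qed.

(** Uniqueness in the resolvent is an a.e. statement about [y] alone. Continuity makes [z 0] vanish
    everywhere, and then the integral of each next component vanishes in turn. *)
Lemma qsol_vanish Q lam z : qsol Q lam (fun=> 0) z -> ae_eq a b (z 0%N) (fun=> 0) ->
  forall k x, (k < m)%N -> a <= x <= b -> z k x = 0.
Proof.
move=> zs z0.
have cint0 x : a <= x <= b -> cint x (fun=> 0) = 0.
  move=> /andP[ax xb].
  by apply: complex_eq; rewrite ?Re_cint ?Im_cint rint_cst// mul0r.
have zB := qsol_bmeas _ _ _ leab _ _ _ _ _ zs.
have zz0 : forall x, a <= x <= b -> z 0%N x = 0.
  apply: (AC_zero _ _ (zs 0%N (m_pos _ m3))) => x xab.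
  rewrite (cint_ae _ _ b _ _ (fun=> 0)) ?cint0//.
    exact/cbmeas_L1/zB/m_pos.
  exact/cbmeas_L1/cbmeas_cst.
have next k w : (k.+1 < m)%N -> AC_with_deriv a b (z k) w ->
    (forall x, a <= x <= b -> w x = z k.+1 x) ->
    (forall x, a <= x <= b -> z k x = 0) -> forall x, a <= x <= b -> z k.+1 x = 0.
  move=> km [wi H] wz zk0; apply: (AC_zero _ _ (zs k.+1 km)) => x xab.
  have /andP[ax xb] := xab.
  have := H x xab; rewrite !zk0 ?lexx// add0r => H0; rewrite [RHS]H0.
  by apply: cint_eq => s /andP[as_ sx]; rewrite wz// as_ (le_trans sx).
elim=> [x _|k IH x km xab]; first exact: zz0.
apply: (next k _ km (zs k (ltnW km))) => // [y yab|y yab]; last exact: IH (ltnW km) yab.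
rewrite /qrhs; have [//|k2] := ltnP k.+2 m.
(* The one equation where the potential interferes; its term carries the factor [z 0], already known
   to be 0. *)
have -> : k.+2 == m by rewrite eqn_leq km k2.
by rewrite zz0// mulr0 subr0.
Qed.

Lemma Lgraph_of_qsol Q al be lam g z : cL2 g -> cL1 Q ->
  qsol Q lam g z -> boundary_vec al be z = 0 ->
  Lgraph a b Q al be (z 0%N) (fun x => g x + lam * z 0%N x).
Proof.
move=> gL2 Qi zs bz; have zB := qsol_bmeas _ _ _ leab _ _ _ _ _ zs.
have z0B := zB _ (m_pos _ m3).
have m2 : (m - 2).+2 = m by rewrite -addn2 subnK// ltnW.
exists z, (fun k x => qrhs R m Q lam g k x (fun j => z j x)); split => //.
- split=> //; split; first exact: zs.
  split=> [k km|].
    apply: aeW => x _; rewrite /qrhs ifT//.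
    by move: km; rewrite -(leq_add2r 2) subnK ?(ltnW m3)// addn2.
  apply: aeW => x _; rewrite /qrhs m2 ltnn eqxx subrK; congr (z _ x).
  by rewrite -{1}m2 subn1.
- exact: cbmeas_L2.
- by apply: cL2D => //; apply: cbmeas_L2; exact: cbmeasZ.
- apply: aeW => x _.
  have m1 : (m - 1).+1 = m by rewrite subn1 prednK// (m_pos _ m3).
  have i0 : ('i : C) ^+ m != 0.
    by rewrite expf_neq0// eq_complex/= oner_eq0 andbF.
  rewrite /qrhs m1 ltnNge leqnSn /= gtn_eqF//.
  by rewrite [in RHS]addrAC subrr add0r mulrA divff// mul1r addrC.
Qed.

(** An eigenfunction relation becomes the homogeneous system: the a.e. identities identify each
    derivative, the last by solving [lam * y = i^m (w - c Q z_1)] for [w]. *)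
Lemma qsol_of_Lgraph Q al be lam y f : cL1 Q -> Lgraph a b Q al be y f ->
  ae_eq a b f (fun x => lam * y x) ->
  exists z, [/\ qsol Q lam (fun=> 0) z, boundary_vec al be z = 0 &
    forall x, a <= x <= b -> z 0%N x = y x].
Proof.
move=> Qi [z [w [[z0y [zw [zw1 zw2]]] _ _ fw bz]]] fy.
exists z; split => // k km.
have zB j : (j < m)%N -> cbmeas (z j) by move=> jm; exact: AC_bmeas (zw j jm).
have gi : cL1 (fun=> 0) by exact/cbmeas_L1/cbmeas_cst.
apply: AC_deriv_ae (zw k km) _ _; first exact: qrhs_L1.
have m2 : (m - 2).+2 = m by rewrite -addn2 subnK// ltnW.
rewrite /qrhs; have [k2|k2] := ltnP k.+2 m.
  have km2 : (k.+1 <= m - 2)%N by rewrite -(leq_add2r 2) subnK ?(ltnW m3)// addn2.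
  by apply: (ae_mono _ _ _ _ (zw1 k km2)) => x H xab; rewrite H.
have [k2e|k2n] := eqVneq k.+2 m.
  have kE : (m - 2)%N = k by rewrite -k2e subn2.
  have kE1 : (m - 1)%N = k.+1 by rewrite -k2e subn1.
  rewrite kE kE1 in zw2; apply: (ae_mono _ _ _ _ zw2) => x H xab.
  by rewrite H// addrK.
have kE : (m - 1)%N = k.
  apply/eqP; rewrite subn1 -eqSS prednK ?(m_pos _ m3)// eqn_leq km andbT.
  by rewrite -ltnS ltn_neqAle eq_sym k2n.
rewrite kE in fw; apply: (ae_mono2 _ _ _ _ _ fw fy) => x H1 H2 xab.
have i0 : ('i : C) ^+ m != 0.
  by rewrite expf_neq0// eq_complex/= oner_eq0 andbF.
have := H1 xab; rewrite H2// => H.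
rewrite z0y// addr0 H mulrA mulVf// mul1r.
by rewrite addrC subrK.
Qed.

(** A homogeneous solution puts [(z 0, lam * z 0)] in the graph, so injectivity kills [z 0], and
    with it all initial data. *)
Lemma resolvent_trivial Q al be lam Rs : cL1 Q ->
  is_resolvent a b Q al be lam Rs -> homogeneous_trivial R a b m Q lam al be.
Proof.
move=> Qi [_ uniq _] z zs bz k km.
have oL2 : cL2 (fun=> 0) by exact/cbmeas_L2/cbmeas_cst.
apply: (qsol_vanish _ _ _ zs) => //; last by rewrite lexx leab.
apply: uniq (Lgraph_of_qsol _ _ _ _ _ _ oL2 Qi zs bz) _.
by apply: aeW => x _; rewrite add0r.
Qed.

End GraphAndNorms.

(** * Norm resolvent convergence *)

Lemma uniform_threshold (R : realType) (I : finType) (P : I -> R -> R -> Prop) :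
  (forall i d, 0 < d -> exists del : R, 0 < del /\ forall e, e < del -> P i d e) ->
  forall d, 0 < d -> exists del : R, 0 < del /\ forall e, e < del -> forall i, P i d e.
Proof.
move=> H d d0; have /choice[D HD] i := H i d d0.
(* The default 1 keeps the threshold positive even for an empty index type. *)
exists (\big[Num.min/1]_i D i); split.
  by apply: lt_bigmin => // i _; exact: (HD i).1.
move=> e lte i; apply: (HD i).2; apply: lt_le_trans lte _; exact: bigmin_le.
Qed.

Theorem theorem2 (R : realType) (a b : R) (m : nat) (eps0 : R)
    (Q : R -> R -> R[i]) (al be : R -> 'M[R[i]]_m) :
  a < b -> (3 <= m)%N -> 0 < eps0 ->
  (forall e, 0 <= e <= eps0 -> cL1 a b (Q e)) ->
  (exists lam, in_resolvent_set a b (Q 0) (al 0) (be 0) lam) ->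
  (* (1)  || (Q_e - Q_0)^vee ||_C -> 0 *)
  (forall d : R, 0 < d -> exists del : R, 0 < del /\
     forall e, 0 < e <= eps0 -> e < del ->
     forall t, a <= t <= b -> `| cint a t (fun s => Q e s - Q 0 s) | <= d%:C) ->
  (* (2)  alpha(e) -> alpha(0), beta(e) -> beta(0) *)
  (forall (i j : 'I_m) (d : R), 0 < d -> exists del : R, 0 < del /\
     forall e, 0 < e <= eps0 -> e < del ->
     `| al e i j - al 0 i j | <= d%:C /\ `| be e i j - be 0 i j | <= d%:C) ->
  (* norm resolvent convergence *)
  exists lam : R[i], in_resolvent_set a b (Q 0) (al 0) (be 0) lam /\
  exists del : R, 0 < del /\
  exists Rs : R -> (R -> R[i]) -> (R -> R[i]),
    (forall e, 0 <= e <= eps0 -> e < del ->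
       is_resolvent a b (Q e) (al e) (be e) lam (Rs e)) /\
    (forall d : R, 0 < d -> exists del' : R, 0 < del' /\
       forall e, 0 < e <= eps0 -> e < del' ->
       forall g, cL2 a b g ->
         cL2norm a b (fun x => Rs e g x - Rs 0 g x) <= d * cL2norm a b g).
Proof.
move=> ltab m3 eps00 Qi [lam [R0 res0]] HQ HM; have leab := ltW ltab.
have o0 : 0 <= (0 : R) <= eps0 by apply/andP; split => //; exact: ltW.
have Q0i := Qi 0 o0.
have triv0 := resolvent_trivial _ _ _ ltab _ m3 _ _ _ _ _ Q0i res0.
exists lam; split; first by exists R0.
have [d0 [K [d00 K0 HK]]] :=
  bvp_perturbation _ _ _ leab _ m3 (Q 0) lam (al 0) (be 0) Q0i triv0.
pose near e d := (forall t, a <= t <= b -> norm1 R (cint a t (fun s => Q e s - Q 0 s)) <= d) /\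
  (mx_norm1 R m (al 0 - al e) <= d /\ mx_norm1 R m (be 0 - be e) <= d).
have close d : 0 < d -> exists del : R, 0 < del /\
    forall e, 0 < e <= eps0 -> e < del -> near e d.
  move=> dpos.
  have [del1 [del10 H1]] := HQ (d / 2) (divr_gt0 dpos (ltr0Sn R 1)).
  have mpos : 0 < m%:R :> R by rewrite ltr0n (leq_trans _ m3).
  (* The 2 offsets [norm1_le_norm], and [m ^ 2] entries are summed in [mx_norm1]. *)
  have dm0 : 0 < d / (2 * (m%:R * m%:R)) by rewrite divr_gt0// !mulr_gt0.
  pose P (p : 'I_m * 'I_m) d e := 0 < e <= eps0 ->
     `| al e p.1 p.2 - al 0 p.1 p.2 | <= d%:C /\ `| be e p.1 p.2 - be 0 p.1 p.2 | <= d%:C.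
  have [p d' d'0|del2 [del20 H2]] := uniform_threshold _ _ P _ _ dm0.
    by have [del [h1 h2]] := HM p.1 p.2 d' d'0; exists del; split=> // e lte ee; exact: h2.
  exists (Num.min del1 del2); split; first by rewrite lt_min del10.
  move=> e ee; rewrite lt_min => /andP[e1 e2]; split=> [t tab|].
    by have := norm1_le_norm _ _ _ (H1 e ee e1 t tab); rewrite mulrC divfK.
  have mnd (A B : 'M[R[i]]_m) :
      (forall i j, `|A i j - B i j| <= (d / (2 * (m%:R * m%:R)))%:C) -> mx_norm1 R m (B - A) <= d.
    move=> AB; apply: (@le_trans _ _ (\sum_(i < m) \sum_(j < m) d / (m%:R * m%:R))).
      apply: ler_sum => i _; apply: ler_sum => j _; rewrite !mxE norm1C.
      apply: le_trans (norm1_le_norm _ _ _ (AB i j)) _.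
      by rewrite le_eqVlt; apply/orP; left; apply/eqP; field; rewrite gt_eqF.
    rewrite !sumr_const !card_ord -mulrnA -(mulr_natr (d / _)) natrM divfK//.
    by rewrite gt_eqF// mulr_gt0.
  by split; apply: mnd => i j; have [] := H2 e e2 (i, j) ee.
(* The convergence hypotheses concern [e > 0]; including [e = 0] at distance 0 lets [Rs 0] come from
   the same construction with the same bounds. *)
have near0 : near 0 0.
  split=> [t /andP[at_ tb]|].
    have -> : cint a t (fun s => Q 0 s - Q 0 s) = 0.
      by rewrite (cintB _ _ b) ?subrr.
    by rewrite norm1_0.
  have mn0 : mx_norm1 R m 0 = 0.
    by rewrite /mx_norm1 big1// => i _; rewrite big1// => j _; rewrite mxE norm1_0.
  by rewrite !subrr !mn0.
have [del [del0 Hdel]] := close d0 d00.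
exists del; split=> //.
have pert e : 0 <= e <= eps0 -> e < del -> exists2 d, 0 <= d <= d0 & near e d.
  move=> /andP[]; rewrite le_eqVlt => /predU1P[<- _ _|e0 ee ed].
    by exists 0; rewrite ?lexx ?ltW.
  by exists d0; rewrite ?lexx ?ltW//; apply: Hdel => //; rewrite e0.
have bound e g z : 0 <= e <= eps0 -> e < del -> cL1 a b g ->
    qsol R a b m (Q e) lam g z -> boundary_vec R a b m (al e) (be e) z = 0 ->
    forall x, a <= x <= b -> vec_norm1 R m (fun k => z k x) <= K * rint R a b (fun s => norm1 R (g s)).
  move=> ee ed gi zs bz.
  have [d dd [h1 [h2 h3]]] := pert e ee ed.
  by have [] := HK (Q e) (al e) (be e) d (Qi e ee) dd h1 h2 h3 g z gi zs bz.
have zL1 : cL1 a b (fun=> 0 : R[i]) by exact/cbmeas_L1/cbmeas_cst.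
have aab : a <= a <= b by rewrite lexx.
(* With [g = 0] the uniform bound kills every homogeneous solution; [bvp] then supplies solutions
   for each small [e]. *)
have triv e : 0 <= e <= eps0 -> e < del ->
    homogeneous_trivial R a b m (Q e) lam (al e) (be e).
  move=> ee ed z zs bz k km; apply/(norm1_eq0 R).
  have := bound e _ z ee ed zL1 zs bz a aab; rewrite (rint_zero _ _ _ leab) mulr0.
  by apply: le_trans; exact: (norm1_le_vec_norm1 _ _ (fun k => z k a)).
(* Solutions are chosen for all pairs [(e, g)] at once, with 0 as default outside the admissible
   range; component 0 is the resolvent. *)
have /choice[Z HZ] (eg : R * (R -> R[i])) : exists z : nat -> R -> R[i],
    0 <= eg.1 <= eps0 -> eg.1 < del -> cL2 a b eg.2 ->
    qsol R a b m (Q eg.1) lam eg.2 z /\ boundary_vec R a b m (al eg.1) (be eg.1) z = 0.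
  case: eg => e g /=.
  have [[ee [ed gL2]]|ng] :=
      pselect (0 <= e <= eps0 /\ e < del /\ cL2 a b g); last first.
    by exists (fun _ _ => 0) => ee ed gL2; exfalso; apply: ng.
  have [H _] := bvp _ _ _ leab _ m3 _ _ _ _ (Qi e ee) (triv e ee ed).
  by have [z Hz] := H g (cL2_L1 _ _ _ g gL2); exists z.
exists (fun e g => Z (e, g) 0%N).
have ZB e g : 0 <= e <= eps0 -> e < del -> cL2 a b g ->
    cbmeas R a b (Z (e, g) 0%N).
  move=> ee ed gL2; have [zs _] := HZ (e, g) ee ed gL2.
  exact: (qsol_bmeas _ _ _ leab _ _ _ _ _ zs) (m_pos _ m3).
have m0 := m_pos _ m3.
have l0 : 0 < 1 + (b - a) by rewrite ltr_pwDl// subr_ge0.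
have normG g : cL2 a b g -> 0 <= rint R a b (fun s => norm1 R (g s)).
  move=> gL2; apply: (rint_ge0 _ _ b) => // [|x _]; last exact: norm1_ge0.
  exact/rL1_norm1/cL2_L1.
split=> [e ee ed|d dpos].
  split.
  - move=> g gL2; have [zs bz] := HZ (e, g) ee ed gL2.
    exact: (Lgraph_of_qsol _ _ _ ltab _ m3 _ _ _ _ _ _ gL2 (Qi e ee) zs bz).
  - move=> y f yf fy.
    have [z [zs bz zy]] := qsol_of_Lgraph _ _ _ ltab _ m3 _ _ _ _ _ _ (Qi e ee) yf fy.
    apply: aeW => x xab; rewrite -zy//; apply/(norm1_eq0 R).
    have := bound e _ z ee ed zL1 zs bz x xab; rewrite (rint_zero _ _ _ leab) mulr0.
    by apply: le_trans; exact: (norm1_le_vec_norm1 _ _ (fun k => z k x)).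
  - exists ((1 + (b - a)) * (K * (1 + (b - a)))) => g gL2.
    have [zs bz] := HZ (e, g) ee ed gL2.
    have gi := cL2_L1 _ _ _ _ gL2.
    have KG := mulr_ge0 K0 (normG g gL2).
    have sup x : a <= x <= b ->
        norm1 R (Z (e, g) 0%N x) <= K * rint R a b (fun s => norm1 R (g s)).
      move=> xab; apply: le_trans (bound e g _ ee ed gi zs bz x xab).
      exact: (norm1_le_vec_norm1 _ _ (fun k => Z (e, g) k x)).
    apply: le_trans (L2norm_le_sup _ _ _ ltab _ _ (ZB e g ee ed gL2) KG sup) _.
    rewrite -!mulrA; apply: ler_wpM2l; first exact: ltW.
    by apply: ler_wpM2l => //; exact: L1_le_L2.
pose L := (1 + (b - a)) * (K * (1 + (b - a))).
have L0 : 0 <= L by rewrite !mulr_ge0// ltW.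
have L1 : 0 < L + 1 by lra.
(* [L] combines both inclusions with [K]; then [L * d1 <= d * L / (L + 1) <= d], the added 1
   covering [L = 0]. *)
pose d1 := Num.min d0 (d / (L + 1)).
have d10 : 0 < d1 by rewrite lt_min d00 divr_gt0.
have [del1 [del10 Hdel1]] := close d1 d10.
exists (Num.min del del1); split; first by rewrite lt_min del0.
move=> e ee; rewrite lt_min => /andP[ed ed1] g gL2.
have ee' : 0 <= e <= eps0 by have /andP[/ltW -> ->] := ee.
have [zs bz] := HZ (e, g) ee' ed gL2.
have [z0s bz0] := HZ (0, g) o0 del0 gL2.
have gi := cL2_L1 _ _ _ _ gL2.
have [h1 [h2 h3]] := Hdel1 e ee ed1.
have dd : 0 <= d1 <= d0 by rewrite (ltW d10) ge_min lexx.
have [_ H] := HK (Q e) (al e) (be e) d1 (Qi e ee') dd h1 h2 h3 g _ gi zs bz.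
have KG : 0 <= K * d1 * rint R a b (fun s => norm1 R (g s)).
  by rewrite !mulr_ge0 ?normG// ltW.
have sup x : a <= x <= b -> norm1 R (Z (e, g) 0%N x - Z (0, g) 0%N x) <=
    K * d1 * rint R a b (fun s => norm1 R (g s)).
  move=> xab; apply: le_trans (H _ z0s bz0 x xab).
  exact: (norm1_le_vec_norm1 _ _ (fun k => Z (e, g) k x - Z (0, g) k x)).
have dB : cbmeas R a b (fun x => Z (e, g) 0%N x - Z (0, g) 0%N x).
  by apply: cbmeasB; exact: ZB.
apply: le_trans (L2norm_le_sup _ _ _ ltab _ _ dB KG sup) _.
set N := cL2norm a b g; have N0 : 0 <= N by exact: cL2norm_ge0.
apply: (@le_trans _ _ (L * d1 * N)).
  rewrite /L -!mulrA; apply: ler_wpM2l; first exact: ltW.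
  rewrite [(1 + _) * _]mulrCA; apply: ler_wpM2l => //; apply: ler_wpM2l; first exact: ltW.
  exact: L1_le_L2.
apply: ler_wpM2r => //; apply: (@le_trans _ _ (L * (d / (L + 1)))).
  by apply: ler_wpM2l => //; rewrite ge_min lexx orbT.
rewrite mulrA ler_pdivrMr// mulrC; apply: ler_wpM2l; first exact: ltW.
by rewrite lerDl.
Qed.
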